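(* Let $X$ be a normed vector space. Let $\Gamma:\mathcal P(\Sigma^{\mathbb N})\to X$ be continuous and affine and let $\Delta:\mathcal P(\Sigma^{\mathbb N})\to\mathbb R$ be continuous and affine with $\Delta(\mu)\neq0$ for all $\mu\in\mathcal P(\Sigma^{\mathbb N})$. Define $U:\mathcal P(\Sigma^{\mathbb N})\to X$ by $U=\frac{\Gamma}{\Delta}$. Let $C$ be a closed and convex subset of $X$ and assume that $$\overset{\circ}{C}\cap U\big(\mathcal P_S(\Sigma^{\mathbb N})\big)\neq\varnothing.$$ Let $\Phi:\Sigma^{\mathbb N}\to\mathbb R$ be continuous with $\Phi<0$. Let $\mathfrak F(C)$ be the unique real number such that $$P^U_C(\mathfrak F(C)\,\Phi)=0;$$ alternatively, $\mathfrak F(C)$ is the unique real number such that $\sigma_{\mathrm{rad}}\big(\zeta^{\mathrm{dyn},U}_C(\mathfrak F(C)\,\Phi;\cdot)\big)=1$. Then $$\mathfrak F(C)=\sup_{\mu\in\mathcal P_S(\Sigma^{\mathbb N}),\ U\mu\in C}\ -\frac{h(\mu)}{\int\Phi\,d\mu}.$$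
   Context: Fix a positive integer $N$; $\Sigma^{\mathbb N}=\{1,\dots,N\}^{\mathbb N}$ is the space of infinite strings (product topology), $\Sigma^n=\{1,\dots,N\}^n$ the strings of length $n$; $|\mathbf i|$ is the length of a finite string $\mathbf i$ and $[\mathbf i]=\{\mathbf j\in\Sigma^{\mathbb N}: \mathbf j \text{ begins with } \mathbf i\}$ its cylinder. $S(i_1i_2\dots)=i_2i_3\dots$ is the shift. $\mathcal P(\Sigma^{\mathbb N})$ denotes the Borel probability measures on $\Sigma^{\mathbb N}$ and $\mathcal P_S(\Sigma^{\mathbb N})$ the shift-invariant ones, both with the weak topology (continuity of $\Gamma,\Delta$ refers to it); affine means $\Gamma(t\mu+(1-t)\nu)=t\Gamma(\mu)+(1-t)\Gamma(\nu)$ for $t\in[0,1]$. $h(\mu)$ is the measure-theoretic entropy of $\mu\in\mathcal P_S(\Sigma^{\mathbb N})$ with respect to $S$. For $n\ge1$ let $L_n:\Sigma^{\mathbb N}\to\mathcal P(\Sigma^{\mathbb N})$, $L_n\mathbf i=\frac1n\sum_{k=0}^{n-1}\delta_{S^k\mathbf i}$, and $UL_n[\mathbf i]=\{U(L_n\mathbf u):\mathbf u\in[\mathbf i]\}$. For $C\subseteq X$ and continuous $\varphi:\Sigma^{\mathbb N}\to\mathbb R$ put $$Z_n(C,\varphi)=\sum_{|\mathbf i|=n,\ UL_n[\mathbf i]\subseteq C}\ \sup_{\mathbf u\in[\mathbf i]}\exp\sum_{k=0}^{n-1}\varphi(S^k\mathbf u).$$ The lower and upper multifractal pressures are $\underline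 P^U_C(\varphi)=\liminf_n\frac1n\log Z_n(C,\varphi)$ and $\overline P^U_C(\varphi)=\limsup_n\frac1n\log Z_n(C,\varphi)$; if they coincide, the common value is written $P^U_C(\varphi)$. The dynamical multifractal zeta-function is the power series $\zeta_C^{\mathrm{dyn},U}(\varphi;z)=\sum_{n\ge1}\frac{z^n}{n}Z_n(C,\varphi)$, and $\sigma_{\mathrm{rad}}(f)\in[0,\infty]$ denotes the radius of convergence of a power series $f$. Empty sums are $0$ and $\log 0=-\infty$. $\overset{\circ}{C}$ is the interior of $C$. *)

(* Defs.v *)
From HB Require Import structures.
From mathcomp Require Import all_boot all_order all_algebra.
From mathcomp Require Import all_classical all_reals all_analysis.

Set Implicit Arguments.
Unset Strict Implicit.
Unset Printing Implicit Defensive.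

Import Order.TTheory GRing.Theory Num.Theory.
Import numFieldNormedType.Exports.

Local Open Scope classical_set_scope.
Local Open Scope ring_scope.

(* Infinite strings over an alphabet of N + 1 letters, so that N ranging over
   nat covers exactly the nonempty finite alphabets. *)
Definition strings (N : nat) : Type := nat -> 'I_N.+1.

HB.instance Definition _ (N : nat) :=
  Choice.copy (strings N) (prod_topology (fun _ : nat => discrete_topology 'I_N.+1)).
HB.instance Definition _ (N : nat) :=
  isPointed.Build (strings N) (fun=> ord0).
HB.instance Definition _ (N : nat) :=
  Uniform.copy (strings N) (prod_topology (fun _ : nat => discrete_topology 'I_N.+1)).
HB.instance Definition _ (N : nat) :=
  Measurable.copy (strings N) (g_sigma_algebraType (@open (strings N))).

Definition shift_map (N : nat) (u : strings N) : strings N := fun k => u k.+1.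

Definition cylinder (N n : nat) (i : n.-tuple 'I_N.+1) : set (strings N) :=
  [set u | forall k : 'I_n, u k = tnth i k].

Definition borel_prob (R : realType) (N : nat) : Type :=
  probability (strings N) R.

(* The weak topology: the coarsest one making mu |-> \int f dmu continuous for
   every continuous (hence, by compactness, bounded) real function f. *)
Definition test_integrals (R : realType) (N : nat) (mu : borel_prob R N) :
    prod_topology (fun _ : continuousType (strings N) R => R) :=
  fun f => \int[mu]_x f x.

HB.instance Definition _ (R : realType) (N : nat) :=
  Choice.copy (borel_prob R N) (probability (strings N) R).
HB.instance Definition _ (R : realType) (N : nat) :=
  Topological.copy (borel_prob R N) (initial_topology (@test_integrals R N)).

Definition shift_invariant (R : realType) (N : nat) : set (borel_prob R N) :=
  [set mu | forall A, measurable A -> mu (@shift_map N @^-1` A) = mu A].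

(* Two probabilities may differ as functions on nonmeasurable sets, so the
   convex combination rho = t mu + (1 - t) nu is tested on measurable sets. *)
Definition affine_prob (R : realType) (N : nat) (V : lmodType R)
    (G : borel_prob R N -> V) : Prop :=
  forall (t : R) (mu nu rho : borel_prob R N), 0 <= t <= 1 ->
    (forall A, measurable A ->
       rho A = t%:E * mu A + (1 - t)%:E * nu A)%E ->
    G rho = t *: G mu + (1 - t) *: G nu.

(* L_n u: the sum of the n point masses normalised by its total mass n.  The
   default measure of mnormalize is used for n = 0 only. *)
Definition empirical (R : realType) (N n : nat) (u : strings N) :
    borel_prob R N :=
  mnormalize (msum (fun k => dirac (iter k (@shift_map N) u)) n) (dirac u).

Lemma empiricalE (R : realType) (N n : nat) (u : strings N) (A : set (strings N)) :
  empirical R n.+1 u A =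
  ((n.+1%:R^-1)%:E * \sum_(k < n.+1) \d_(iter k (@shift_map N) u) A)%E.
Proof.
have mT : msum (fun k => @dirac _ _ (iter k (@shift_map N) u) R) n.+1 setT = n.+1%:R%:E.
  rewrite /msum (eq_bigr (fun=> 1%E)) => [|k _]; last exact: diracT.
  by rewrite sumEFin sumr_const card_ord.
rewrite /empirical /= /mnormalize; have -> : forall x, x = n.+1%:R%:E :> \bar R ->
    ((x == 0) || (x == +oo))%E = false by move=> x ->; rewrite eqe pnatr_eq0.
  by rewrite [X in fine X](mT) /msum muleC.
exact: mT.
Qed.

Definition birkhoff_sum (R : realType) (N : nat) (phi : strings N -> R) (n : nat)
    (u : strings N) : R :=
  \sum_(k < n) phi (iter k (@shift_map N) u).

Definition partition_sum (R : realType) (N : nat) (X : normedModType R)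
    (U : borel_prob R N -> X) (C : set X) (phi : strings N -> R) (n : nat) : R :=
  \sum_(i : n.-tuple 'I_N.+1 |
        `[< [set U (empirical R n u) | u in cylinder i] `<=` C >])
     sup [set expR (birkhoff_sum phi n u) | u in cylinder i].

Definition lower_pressure (R : realType) (N : nat) (X : normedModType R)
    (U : borel_prob R N -> X) (C : set X) (phi : strings N -> R) : \bar R :=
  limn_einf (fun n => (n%:R^-1)%:E * lne (partition_sum U C phi n)%:E)%E.

Definition upper_pressure (R : realType) (N : nat) (X : normedModType R)
    (U : borel_prob R N -> X) (C : set X) (phi : strings N -> R) : \bar R :=
  limn_esup (fun n => (n%:R^-1)%:E * lne (partition_sum U C phi n)%:E)%E.

Definition is_pressure (R : realType) (N : nat) (X : normedModType R)
    (U : borel_prob R N -> X) (C : set X) (phi : strings N -> R)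
    (p : \bar R) : Prop :=
  lower_pressure U C phi = p /\ upper_pressure U C phi = p.

(* Coefficient of z ^ n in the zeta-function; it is 0 for n = 0 since
   0^-1 = 0. *)
Definition zeta_coef (R : realType) (N : nat) (X : normedModType R)
    (U : borel_prob R N -> X) (C : set X) (phi : strings N -> R) : R^nat :=
  fun n => n%:R^-1 * partition_sum U C phi n.

(* For real coefficients, real z determine the radius of the disc of
   convergence. *)
Definition convergence_radius (R : realType) (a : R^nat) : \bar R :=
  ereal_sup [set `|z|%:E | z in [set z : R | cvgn (pseries a z)]].

Section entropy.
Context (R : realType) (d : measure_display) (T : measurableType d).
Variables (S : T -> T) (mu : probability T R).

Definition measurable_partition (k : nat) (A : 'I_k -> set T) : Prop :=
  [/\ forall j, measurable (A j), trivIset setT A & \bigcup_j A j = setT].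

(* The atoms of the join of A, S^-1 A, ..., S^-(n-1) A, indexed by words. *)
Definition join_atom (k : nat) (A : 'I_k -> set T) (n : nat)
    (w : n.-tuple 'I_k) : set T :=
  [set x | forall l : 'I_n, A (tnth w l) (iter l S x)].

Definition join_entropy (k : nat) (A : 'I_k -> set T) (n : nat) : R :=
  - \sum_(w : n.-tuple 'I_k)
      fine (mu (join_atom A w)) * ln (fine (mu (join_atom A w))).

Definition entropy_partition (k : nat) (A : 'I_k -> set T) : \bar R :=
  limn (fun n => (n%:R^-1 * join_entropy A n)%:E).

Definition entropy : \bar R :=
  ereal_sup [set h | exists (k : nat) (A : 'I_k -> set T),
    measurable_partition A /\ h = entropy_partition A].

End entropy.

(* Main.v *)
Require Import Defs.
From HB Require Import structures.
From mathcomp Require Import all_boot all_order all_algebra.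
From mathcomp Require Import all_classical all_reals all_analysis.
From mathcomp Require Import ring lra zify.

Set Implicit Arguments.
Unset Strict Implicit.
Unset Printing Implicit Defensive.

Import Order.TTheory GRing.Theory Num.Theory.
Import numFieldNormedType.Exports.

Local Open Scope classical_set_scope.
Local Open Scope ring_scope.

(* Let F be the supremum on the right-hand side, so that h + F int Phi <= 0 on the
   invariant measures mu with U mu in C.  It suffices that the partition sums Z_n of
   F Phi grow with exponential rate 0, since scaling Phi shifts this rate strictly.
   Upper bound: put the Gibbs weights p on the words w of length n with U L_n [w] in C,
   concatenate independent p-words and average over the n shifts.  As C is convex and
   closed, the resulting invariant measure mu satisfies U mu in C exactly; its entropy
   is at least H(p) / n and its integral is at least the p-mean of the Birkhoff sums
   over n, up to o(1), so ln Z_n / n <= h + F int Phi + o(1).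
   Lower bound: a measure mu with U mu in C is first moved into the interior by mixing
   it with the given measure.  Concatenating blocks of length m in the proportions
   mu [w] (typical sequences for the product of the laws of the blocks, by Chebyshev's
   inequality) produces about exp (n H_m / m) words of length n all of whose empirical
   measures are weakly close to mu; no ergodicity is needed.  The entropy of mu is the
   limit of H_m / m by the Kolmogorov-Sinai theorem for the coordinate partition. *)

(** * Entropy and typical sequences on finite sets *)

Section finite_entropy.
Context {R : realType}.

(** The quotient [U] is not affine. But [Delta] is affine and never vanishes, so it has constant
    sign, and [U] of a mixture is a convex combination of the values of [U] with modified weights:
    this is how convexity of [C] enters both bounds. A word counts in a partition sum only if its
    whole cylinder is sent into [C]. For the upper bound this makes every empirical measure read off
    a block admissible; for the lower bound it forces the detour through the interior, since
    closeness to [mu], known for all points of a cylinder at once, must already imply membership in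
    [C]. The measure of the upper bound is built at one fixed [n], where its entropy, its integral
    and its position with respect to [C] are controlled directly, not through a weak limit. Weak
    closeness is always expressed by the probabilities of words of one finite length, which turns
    integrals and values of [U] into questions about finite sums. *)

Definition shannon (T : finType) (p : T -> R) : R := - \sum_t p t * ln (p t).

Lemma ln_le_subr1 (x : R) : 0 < x -> ln x <= x - 1.
Proof.
by move=> x0; rewrite lerBrDl -{2}(lnK x0) expR_ge1Dx.
Qed.

(** Multiply [ln x <= x - 1] at [x = q t / p t] by [p t] and sum. Most entropy estimates below are
    this inequality for a suitable [q]. *)
Lemma gibbs (T : finType) (p q : T -> R) :
  (forall t, 0 <= p t) -> \sum_t p t = 1 ->
  (forall t, 0 <= q t) -> \sum_t q t <= 1 -> (forall t, 0 < p t -> 0 < q t) ->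
  shannon p <= - \sum_t p t * ln (q t).
Proof.
move=> p0 p1 q0 q1 pq; rewrite lerN2 -subr_ge0 -sumrB.
rewrite (@le_trans _ _ (\sum_t (p t - q t)))//.
  by rewrite sumrB p1 subr_ge0.
apply: ler_sum => t _.
have [pt0|pt0] := ltrP 0 (p t); last first.
  have -> : p t = 0 by apply/eqP; rewrite eq_le pt0 p0.
  by rewrite !mul0r subr0 sub0r oppr_le0.
have qt0 := pq _ pt0.
have := ln_le_subr1 (divr_gt0 qt0 pt0); rewrite ln_div ?posrE//.
rewrite -(ler_pM2l pt0) mulrBr mulrBr mulrCA divff ?gt_eqF// !mulr1; lra.
Qed.

Lemma pmf_le1 (T : finType) (p : T -> R) t :
  (forall t, 0 <= p t) -> \sum_t p t = 1 -> p t <= 1.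
Proof. by move=> p0 <-; rewrite (bigD1 t)//= lerDl sumr_ge0. Qed.

Lemma shannon_ge0 (T : finType) (p : T -> R) :
  (forall t, 0 <= p t) -> \sum_t p t = 1 -> 0 <= shannon p.
Proof.
move=> p0 p1; rewrite /shannon oppr_ge0 sumr_le0// => t _.
by rewrite mulr_ge0_le0// ln_le0// (pmf_le1 _ p0 p1).
Qed.

Lemma shannon_le_card (T : finType) (p : T -> R) :
  (forall t, 0 <= p t) -> \sum_t p t = 1 -> shannon p <= ln #|T|%:R.
Proof.
move=> p0 p1.
have T0 : (0 < #|T|)%N.
  apply/card_gt0P; apply/existsP; apply: contraT; rewrite negb_exists => /forallP T0.
  by move: p1; rewrite big1 => [/eqP|i _]; [rewrite eq_sym oner_eq0|have := T0 i].
have := @gibbs T p (fun=> #|T|%:R^-1) p0 p1.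
rewrite -mulr_suml p1 mul1r lnV ?posrE ?ltr0n// opprK; apply.
- by move=> t; rewrite invr_ge0.
- by rewrite sumr_const -[leLHS]mulr_natr mulVf// pnatr_eq0 -lt0n.
- by move=> t _; rewrite invr_gt0 ltr0n.
Qed.

(** Merging letters only enlarges the masses inside the logarithms: [p t] is at most the mass of its
    fibre under [g]. *)
Lemma shannon_map (T S : finType) (p : T -> R) (g : T -> S) :
  (forall t, 0 <= p t) ->
  shannon (fun s => \sum_(t | g t == s) p t) <= shannon p.
Proof.
move=> p0; rewrite /shannon lerN2.
under [leRHS]eq_bigr do rewrite mulr_suml.
rewrite [leRHS](exchange_big_dep xpredT)//=; apply: ler_sum => t _.
rewrite (big_pred1 (g t)) => [|s]; last by rewrite /= eq_sym.
have [pt0|pt0] := ltrP 0 (p t); last first.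
  have -> : p t = 0 by apply/eqP; rewrite eq_le pt0 p0.
  by rewrite !mul0r.
have h : p t <= \sum_(i | g i == g t) p i.
  by rewrite (bigD1 t)//= lerDl sumr_ge0.
by rewrite ler_pM2l// ler_ln ?posrE// (lt_le_trans pt0).
Qed.

(** Concavity of the entropy: Gibbs' inequality for each [p j] against the common mixture. Indices
    with [a j = 0] are set apart because the mixture need not charge the letters of such a [p j]. *)
Lemma shannon_mix (T J : finType) (a : J -> R) (p : J -> T -> R) :
  (forall j, 0 <= a j) -> \sum_j a j = 1 ->
  (forall j t, 0 <= p j t) -> (forall j, \sum_t p j t = 1) ->
  \sum_j a j * shannon (p j) <= shannon (fun t => \sum_j a j * p j t).
Proof.
move=> a0 a1 p0 p1; rewrite /shannon.
under [X in _ <= - X]eq_bigr do rewrite mulr_suml.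
rewrite exchange_big/= -sumrN; apply: ler_sum => j _.
have [aj0|aj0] := ltrP 0 (a j); last first.
  have -> : a j = 0 by apply/eqP; rewrite eq_le aj0 a0.
  by rewrite mul0r big1 ?oppr0// => t _; rewrite !mul0r.
under [X in _ <= - X]eq_bigr do rewrite -mulrA.
rewrite -mulr_sumr -mulrN ler_pM2l//; apply: gibbs => //.
- by move=> t; apply: sumr_ge0 => i _; rewrite mulr_ge0.
- rewrite exchange_big/= -a1; apply: ler_sum => i _.
  by rewrite -mulr_sumr p1 mulr1.
- move=> t pt; rewrite (bigD1 j)//= ltr_wpDr//; last exact: mulr_gt0.
  by apply: sumr_ge0 => i _; rewrite mulr_ge0.
Qed.

Lemma ln_prod (J : finType) (F : J -> R) : (forall j, 0 < F j) ->
  ln (\prod_j F j) = \sum_j ln (F j).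
Proof.
move=> F0.
have: 0 < \prod_j F j /\ ln (\prod_j F j) = \sum_j ln (F j); last by case.
elim/big_rec2: _ => [|j a b _ [b0 ab]]; first by rewrite ln1.
by rewrite mulr_gt0//; split => //; rewrite lnM ?posrE// ab.
Qed.

Section product.
Variables (T : finType) (p : T -> R) (k : nat).
Hypotheses (p0 : forall t, 0 <= p t) (p1 : \sum_t p t = 1).

Definition prodp (x : {ffun 'I_k -> T}) : R := \prod_i p (x i).

Lemma prodp_ge0 x : 0 <= prodp x.
Proof. exact: prodr_ge0. Qed.

Lemma sum_prodp : \sum_x prodp x = 1.
Proof.
rewrite -(bigA_distr_bigA (fun _ t => p t)).
by rewrite big1.
Qed.

Lemma prodp_marginal (y : T -> R) i :
  \sum_x prodp x * y (x i) = \sum_t p t * y t.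
Proof.
transitivity (\sum_(x : {ffun 'I_k -> T}) \prod_l (p (x l) * if l == i then y (x l) else 1)).
  apply: eq_bigr => x _; rewrite big_split/=; congr (_ * _).
  by rewrite -big_mkcond/= big_pred1_eq.
rewrite -(bigA_distr_bigA (fun l t => p t * if l == i then y t else 1)).
rewrite (bigD1 i)//= eqxx [X in _ * X]big1 ?mulr1// => j ji.
by rewrite (negbTE ji); under eq_bigr do rewrite mulr1.
Qed.

Lemma prodp_marginal2 (y z : T -> R) i j : i != j ->
  \sum_x prodp x * (y (x i) * z (x j)) = (\sum_t p t * y t) * (\sum_t p t * z t).
Proof.
move=> ij; have ji : j != i by rewrite eq_sym.
pose F l t := p t * ((if l == i then y t else 1) * if l == j then z t else 1).
transitivity (\sum_(x : {ffun 'I_k -> T}) \prod_l F l (x l)).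
  apply: eq_bigr => x _; rewrite /F !big_split/=; congr (_ * (_ * _)).
  - by rewrite -big_mkcond/= big_pred1_eq.
  - by rewrite -big_mkcond/= big_pred1_eq.
rewrite -(bigA_distr_bigA F) (bigD1 i)//= (bigD1 j)//= [X in _ * (_ * X)]big1 ?mulr1.
  congr (_ * _).
  - by apply: eq_bigr => t _; rewrite /F eqxx (negbTE ij) mulr1.
  - by apply: eq_bigr => t _; rewrite /F eqxx (negbTE ji) mul1r.
move=> l /andP[li lj]; rewrite -[RHS]p1.
by apply: eq_bigr => t _; rewrite /F (negbTE li) (negbTE lj) !mulr1.
Qed.

Lemma ln_prodp x : 0 < prodp x -> ln (prodp x) = \sum_i ln (p (x i)).
Proof.
move=> x0; have px i : 0 < p (x i).
  rewrite lt_neqAle p0 andbT eq_sym; apply: contraTN x0 => /eqP xi0.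
  by rewrite /prodp (bigD1 i)//= xi0 mul0r ltxx.
exact: ln_prod.
Qed.

Lemma shannon_prodp : shannon prodp = k%:R * shannon p.
Proof.
rewrite /shannon mulrN; congr (- _).
transitivity (\sum_x \sum_i prodp x * ln (p (x i))).
  apply: eq_bigr => x _; rewrite -mulr_sumr.
  have [x0|x0] := ltrP 0 (prodp x); last first.
    have -> : prodp x = 0 by apply/eqP; rewrite eq_le x0 prodp_ge0.
    by rewrite !mul0r.
  by rewrite ln_prodp.
rewrite exchange_big/= mulr_natl -[k in RHS]card_ord -sumr_const.
by apply: eq_bigr => i _; rewrite (prodp_marginal (fun t => ln (p t))).
Qed.

(** The centred variable [z] is bounded by [2 * B] and independence kills the cross terms, so the
    variance of the sum is at most [k * (2 * B) ^ 2]; dividing by [(k * d) ^ 2] gives the bound. *)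
Lemma chebyshev_prodp (y : T -> R) (B d : R) : (0 < k)%N -> 0 < d -> 0 <= B ->
  (forall t, `|y t| <= B) ->
  \sum_(x : {ffun 'I_k -> T} | k%:R * d < `|\sum_i y (x i) - k%:R * \sum_t p t * y t|) prodp x
   <= (2 * B / d) ^+ 2 / k%:R.
Proof.
move=> k0 d0 B0 yB; set m := \sum_t p t * y t.
have mB : `|m| <= B.
  rewrite (le_trans (ler_norm_sum _ _ _))// -[leRHS]mul1r -p1 mulr_suml.
  by apply: ler_sum => t _; rewrite normrM ger0_norm// ler_wpM2l.
pose z t := y t - m.
have z0 : \sum_t p t * z t = 0.
  under eq_bigr do rewrite mulrBr.
  by rewrite sumrB -mulr_suml p1 mul1r subrr.
have zB t : z t * z t <= (2 * B) ^+ 2.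
  rewrite -expr2 -real_normK ?num_real// ler_sqr ?nnegrE ?mulr_ge0//.
  by rewrite (le_trans (ler_normB _ _))// mulr_natl mulr2n lerD.
have zE x : \sum_(i < k) y (x i) - k%:R * m = \sum_(i < k) z (x i).
  by rewrite sumrB sumr_const card_ord mulr_natl.
have V : \sum_(x : {ffun 'I_k -> T}) prodp x * (\sum_i z (x i)) ^+ 2 <= k%:R * (2 * B) ^+ 2.
  rewrite (_ : \sum_x _ = \sum_i \sum_j \sum_(x : {ffun 'I_k -> T}) prodp x * (z (x i) * z (x j))); last first.
    rewrite (eq_bigr (fun x : {ffun 'I_k -> T} => \sum_i \sum_j prodp x * (z (x i) * z (x j)))).
      by rewrite exchange_big/=; apply: eq_bigr => i _; rewrite exchange_big.
    move=> x _; rewrite expr2 mulr_suml mulr_sumr; apply: eq_bigr => i _.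
    by rewrite mulr_sumr mulr_sumr.
  rewrite [leRHS](_ : _ = \sum_(i < k) (2 * B) ^+ 2); last first.
    by rewrite sumr_const card_ord mulr_natl.
  apply: ler_sum => i _.
  rewrite (bigD1 i)//= [X in _ + X]big1 ?addr0 => [|j ji].
    rewrite -[leRHS]mul1r -[X in _ <= X * _]sum_prodp mulr_suml; apply: ler_sum => x _.
    by rewrite ler_wpM2l// prodp_ge0.
  by rewrite prodp_marginal2 1?eq_sym// z0 mul0r.
have kR : 0 < k%:R :> R by rewrite ltr0n.
have kd0 : 0 < (k%:R * d) ^+ 2 by rewrite exprn_gt0// mulr_gt0.
rewrite -(ler_pM2l kd0).
rewrite (_ : _ * ((2 * B / d) ^+ 2 / k%:R) = k%:R * (2 * B) ^+ 2); last first.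
  by field; rewrite ?gt_eqF.
apply: le_trans V; rewrite mulr_sumr big_mkcond/=; apply: ler_sum => x _.
case: ifPn => [h|_]; last by rewrite mulr_ge0 ?prodp_ge0 ?sqr_ge0.
rewrite mulrC ler_wpM2l ?prodp_ge0//.
rewrite -[leRHS]real_normK ?num_real// ler_sqr ?nnegrE ?mulr_ge0 ?(ltW d0)//.
by rewrite -zE ltW.
Qed.

End product.

(** Union bound over the observables [j], each treated by Chebyshev's inequality. The value one half
    is a convenience: a factor independent of [k] does not change exponential rates. *)
Lemma prodp_typical (T J : finType) (p : T -> R) (y : J -> T -> R) (d : R) :
  (forall t, 0 <= p t) -> \sum_t p t = 1 -> 0 < d ->
  \forall k \near \oo,
    2^-1 <= \sum_(x : {ffun 'I_k -> T} |
       [forall j, `|\sum_i y j (x i) - k%:R * \sum_t p t * y j t| <= k%:R * d])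
       prodp p x.
Proof.
move=> p0 p1 d0.
pose B := \sum_j \sum_t `|y j t|.
have B0 : 0 <= B by apply: sumr_ge0 => j _; exact: sumr_ge0.
have yB j t : `|y j t| <= B.
  rewrite /B (bigD1 j)//= (bigD1 t)//= -addrA lerDl addr_ge0//.
    exact: sumr_ge0.
  by apply: sumr_ge0 => i _; exact: sumr_ge0.
pose c := #|J|%:R * (2 * B / d) ^+ 2.
near=> k.
have k0 : (0 < k)%N by near: k; exists 1%N.
have kR : 0 < k%:R :> R by rewrite ltr0n.
have ck : c / k%:R <= 2^-1.
  rewrite ler_pdivrMr// mulrC -ler_pdivrMr// invrK.
  by near: k; exact: nbhs_infty_ger.
set G := BIG_P.
pose bad j (x : {ffun 'I_k -> T}) := k%:R * d < `|\sum_i y j (x i) - k%:R * \sum_t p t * y j t|.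
have : \sum_(x | ~~ G x) prodp p x <= c / k%:R.
  rewrite (@le_trans _ _ (\sum_j \sum_(x | bad j x) prodp p x))//.
    rewrite (exchange_big_dep xpredT)//= [leLHS]big_mkcond/=.
    apply: ler_sum => x _; case: ifPn => [|_]; last first.
      by apply: sumr_ge0 => *; exact: prodp_ge0.
    rewrite negb_forall => /existsP[j]; rewrite -ltNge => jx.
    rewrite (bigD1 j)//= lerDl.
    by apply: sumr_ge0 => *; exact: prodp_ge0.
  rewrite /c -mulrA mulr_natl -sumr_const; apply: ler_sum => j _.
  exact: chebyshev_prodp.
have := sum_prodp k p1; rewrite (bigID G)/=; lra.
Unshelve. all: by end_near. Qed.

(** The limit is the infimum [l] of [a n / n] over positive [n]: for a nearly optimal [n.+1], divide
    [k] by [n.+1] and use subadditivity. *)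
Lemma fekete (a : R^nat) : (forall n, 0 <= a n) ->
  (forall m n, a (m + n)%N <= a m + a n) ->
  cvgn (fun n => n%:R^-1 * a n).
Proof.
move=> a0 asub.
pose u n := n.+1%:R^-1 * a n.+1.
have a0E n : 0 <= u n by rewrite mulr_ge0.
pose l := inf (range u).
have lu n : l <= u n by apply: ge_inf; [exists 0 => _ [m _ <-]|exists n].
have amul m n : a (m * n.+1)%N <= m%:R * a n.+1 + a 0%N.
  elim: m => [|m IH]; first by rewrite mul0n mul0r add0r.
  rewrite mulSn (le_trans (asub _ _))// -natr1; lra.
apply/cvg_ex; exists l; apply/cvgrPdist_le => e e0.
have [_ [n _ <-] une] : exists2 x, range u x & x < l + e / 2.
  by apply: inf_adherent; [rewrite divr_gt0|split; [exists (u 0%N); exists 0%N|exists 0 => _ [m _ <-]]].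
(* Bounds what does not grow with [k]: the value at the remainder and the term [a 0] left over in
   [amul]. *)
pose M := \sum_(i < n.+1) a i + a 0%N.
near=> k.
have k0 : (0 < k)%N by near: k; exists 1%N.
have kR : 0 < k%:R :> R by rewrite ltr0n.
have kM : M <= k%:R * (e / 2).
  by rewrite -ler_pdivrMr ?divr_gt0//; near: k; exact: nbhs_infty_ger.
have lk : l <= k%:R^-1 * a k by have := lu k.-1; rewrite /u prednK.
rewrite distrC ger0_norm ?subr_ge0// lerBlDr mulrC ler_pdivrMr//.
rewrite {1}(divn_eq k n.+1) (le_trans (asub _ _))//.
have h1 : a (k %% n.+1)%N <= \sum_(i < n.+1) a i.
  have lt : (k %% n.+1 < n.+1)%N by rewrite ltn_mod.
  by rewrite (bigD1 (Ordinal lt))//= lerDl sumr_ge0.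
have h2 := amul (k %/ n.+1)%N n.
have h3 : (k %/ n.+1)%:R * a n.+1 <= k%:R * u n.
  rewrite /u mulrA ler_wpM2r// ler_pdivlMr ?ltr0n//.
  by rewrite -natrM ler_nat leq_trunc_div.
have h4 : k%:R * u n <= k%:R * (l + e / 2) by rewrite ler_pM2l// ltW.
rewrite /M in kM; nra.
Unshelve. all: by end_near. Qed.

(** On [W] one has [ln (p t) = a t - ln Z], so entropy and mean energy add up to [ln Z]: the Gibbs
    weights attain the finite variational principle. *)
Lemma gibbs_attained (T : finType) (W : {pred T}) (a : T -> R) :
  let Z := \sum_(t in W) expR (a t) in 0 < Z ->
  let p t := if t \in W then expR (a t) / Z else 0 in
  [/\ forall t, 0 <= p t, \sum_t p t = 1 & shannon p + \sum_t p t * a t = ln Z].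
Proof.
move=> Z Z0 p.
have p0 t : 0 <= p t by rewrite /p; case: ifP => // _; rewrite divr_ge0 ?expR_ge0// ltW.
have p1 : \sum_t p t = 1.
  by rewrite /p -big_mkcond/= -mulr_suml divff// gt_eqF.
split => //; rewrite /shannon addrC -sumrB -[RHS]mul1r -p1 mulr_suml.
apply: eq_bigr => t _; rewrite -mulrBr /p; case: ifP => _; last by rewrite !mul0r.
by rewrite ln_div ?posrE ?expR_gt0// expRK opprB addrC subrK.
Qed.

Lemma bigA_distr_tuple (S : finType) (n : nat) (F : 'I_n -> S -> R) :
  \sum_(t : n.-tuple S) \prod_i F i (tnth t i) = \prod_i \sum_s F i s.
Proof.
rewrite bigA_distr_bigA (reindex (fun f : {ffun 'I_n -> S} => [tuple f i | i < n]))/=.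
  by apply: eq_bigr => f _; apply: eq_bigr => i _; rewrite tnth_mktuple.
exists (fun t : n.-tuple S => [ffun i => tnth t i]) => f _.
  by apply/ffunP => i; rewrite ffunE tnth_mktuple.
by apply: eq_from_tnth => i; rewrite tnth_mktuple ffunE.
Qed.

End finite_entropy.

(** * Strings, cylinders and finite-valued functions *)

Lemma forall_measurable d (T : measurableType d) (I : finType) (F : I -> set T) :
  (forall i, measurable (F i)) -> measurable [set x | forall i, F i x].
Proof.
move=> mF; rewrite (_ : [set x | _] = ~` \bigcup_(i in setT) ~` F i).
  apply: measurableC; apply: fin_bigcup_measurable; first exact: finite_finset.
  by move=> i _; exact: measurableC.
rewrite setC_bigcup; apply/seteqP; split => x h i; last by have := h i Logic.I; rewrite setCK.
by move=> _; rewrite setCK; exact: h.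
Qed.

Section strings_topology.
Context {N : nat}.
Notation I := 'I_N.+1.
Implicit Types u v : strings N.

Definition word (s n : nat) u : n.-tuple I := [tuple u (s + k)%N | k < n].

Definition fill (n : nat) (w : n.-tuple I) : strings N := fun k => nth ord0 w k.

Lemma tnth_word s n u (k : 'I_n) : tnth (word s n u) k = u (s + k)%N.
Proof. by rewrite tnth_mktuple. Qed.

Lemma eq_wordP s s' n u v :
  (forall k, (k < n)%N -> u (s + k)%N = v (s' + k)%N) <-> word s n u = word s' n v.
Proof.
split=> [uv|/eqP h k kn].
  by apply: eq_from_tnth => k; rewrite !tnth_word uv.
by have /eqP/(congr1 (fun t => tnth t (Ordinal kn))) := h; rewrite !tnth_word.
Qed.

Lemma cylinderE n (w : n.-tuple I) u : cylinder w u <-> word 0 n u = w.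
Proof.
split=> [h|<- k]; last by rewrite tnth_word.
by apply: eq_from_tnth => k; rewrite tnth_word h.
Qed.

Lemma word_fill n (w : n.-tuple I) : word 0 n (fill w) = w.
Proof. by apply/cylinderE => k; rewrite /fill (tnth_nth ord0). Qed.

Lemma iter_shift l u k : iter l (@shift_map N) u k = u (l + k)%N.
Proof. by elim: l k => //= l IH k; rewrite /shift_map IH addnS addSn. Qed.

Lemma word_iter_shift l s n u : word s n (iter l (@shift_map N) u) = word (l + s) n u.
Proof. by apply/eq_wordP => k _; rewrite iter_shift addnA. Qed.

Lemma word_le s n m u v : (n <= m)%N -> word s m u = word s m v -> word s n u = word s n v.
Proof. by move=> nm /eq_wordP h; apply/eq_wordP => k kn; apply: h; apply: leq_trans nm. Qed.

Definition cyl_filter u : set_system (strings N) :=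
  filter_from setT (fun n => cylinder (word 0 n u)).

Instance cyl_filter_filter u : Filter (cyl_filter u).
Proof.
apply: filter_from_filter; first by exists 0%N.
move=> i j _ _; exists (maxn i j) => //.
by move=> v /cylinderE h; split; apply/cylinderE; apply: word_le h;
  rewrite ?leq_maxl ?leq_maxr.
Qed.

(** The cylinders around [u] generate a filter that converges to [u] in each coordinate, hence in
    the product topology. *)
Lemma nbhs_strings u A : nbhs u A -> exists n, cylinder (word 0 n u) `<=` A.
Proof.
move=> uA.
suff : cyl_filter u --> u by move=> /(_ _ uA) [n _ nA]; exists n.
apply/cvg_sup => i B /= [V [] [W oW WV] Vu VB].
exists i.+1 => //; apply: subset_trans VB => v /(_ ord_max).
by rewrite tnth_word/= add0n => vu; rewrite -WV /= vu; rewrite -WV in Vu.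
Qed.

Lemma coord_continuous k : continuous ((fun u => u k) : strings N -> discrete_topology I).
Proof. exact: (@proj_continuous nat (fun=> discrete_topology I) k). Qed.

Lemma coord_nbhs u k : \forall v \near u, v k = u k.
Proof. by apply: (@coord_continuous k u [set u k]); exact: discrete_set1. Qed.

Lemma cylinder_nbhs n u : nbhs u (cylinder (word 0 n u)).
Proof.
apply: (@filter_forall _ 'I_n (fun k : 'I_n => [set v | v k = tnth (word 0 n u) k]) (nbhs u) _ _) => k.
rewrite tnth_word add0n; exact: coord_nbhs.
Qed.

Lemma cylinder_open n (w : n.-tuple I) : open (cylinder w).
Proof.
rewrite openE => u uw; have /cylinderE <- := uw; exact: cylinder_nbhs.
Qed.

Lemma strings_compact : compact [set: strings N].
Proof.
have := @tychonoff nat (fun=> discrete_topology I) (fun=> setT)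
  (fun=> @finite_compact (discrete_topology I) setT (@finite_finset I setT)).
by rewrite (_ : [set f | _] = setT)//; apply/seteqP; split.
Qed.

(** Uniform continuity: continuity gives a depth that works near one point, and compactness in its
    near-covering form makes one bound serve all points. The error [e / 2] against the centre
    doubles for two points of its cylinder. *)
Lemma continuous_word {R : realType} (f : strings N -> R) (e : R) :
  continuous f -> 0 < e ->
  \forall n \near \oo, forall u v, word 0 n u = word 0 n v -> `|f u - f v| <= e.
Proof.
move=> cf e0.
have /compact_near_coveringP cover := strings_compact.
pose close n u := forall v, word 0 n u = word 0 n v -> `|f u - f v| <= e.
have : \forall n \near \oo, [set: strings N] `<=` close n.
  apply: cover => u _.
  have /cvgrPdist_le/(_ _ (divr_gt0 e0 (ltr0n _ 2)))/nbhs_strings[n ne] := cf u.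
  exists (cylinder (word 0 n u), [set m | (n <= m)%N]).
    by split; [exact: cylinder_nbhs|exists n].
  move=> [v m] /= [nv nm] v' vv'.
  have uv' : cylinder (word 0 n u) v'.
    by move/cylinderE : nv => <-; apply/cylinderE; rewrite (word_le nm vv').
  have := ne _ nv; have := ne _ uv'; rewrite /= => h1 h2.
  rewrite (_ : f v - f v' = (f u - f v') - (f u - f v)); last by ring.
  by rewrite (le_trans (ler_normB _ _))// [e]splitr lerD.
by apply: filterS => n h u v; apply: h.
Qed.

Lemma continuous_bounded {R : realType} (f : strings N -> R) :
  continuous f -> exists M, forall u, `|f u| <= M.
Proof.
move=> cf.
have [n _ nf] := continuous_word cf ltr01.
exists (\sum_(w : n.-tuple I) `|f (fill w)| + 1) => u.
have := nf n (leqnn n) u (fill (word 0 n u)); rewrite word_fill => /(_ erefl).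
rewrite (bigD1 (word 0 n u))//=.
have : 0 <= \sum_(i | i != word 0 n u) `|f (fill i)| by apply: sumr_ge0.
have := ler_normD (f u - f (fill (word 0 n u))) (f (fill (word 0 n u))).
rewrite subrK; lra.
Qed.

Lemma continuous_lt0_bounded {R : realType} (f : strings N -> R) :
  continuous f -> (forall u, f u < 0) -> exists2 c, 0 < c & forall u, f u <= - c.
Proof.
move=> cf f0.
have [||c _ fc] := @compact_EVT_max _ _ f setT _ strings_compact.
- by exists point.
- exact: continuous_subspaceT.
exists (- f c); first by rewrite oppr_gt0.
by move=> u; rewrite opprK fc// inE.
Qed.

Lemma cylinder_measurable n (w : n.-tuple I) : measurable (cylinder w).
Proof. by apply: sub_sigma_algebra; exact: cylinder_open. Qed.

Lemma open_bigcup_cylinder (A : set (strings N)) : open A ->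
  A = \bigcup_n \bigcup_(w in [set w : n.-tuple I | cylinder w `<=` A]) cylinder w.
Proof.
rewrite openE => oA; apply/seteqP; split => [u /oA/nbhs_strings[n nA]|u [n _ [w wA /wA//]]].
by exists n => //; exists (word 0 n u) => //; apply/cylinderE.
Qed.

Lemma measurable_strings_fun d (T : measurableType d) (f : T -> strings N) :
  (forall k a, measurable [set x | f x k = a]) -> measurable_fun setT f.
Proof.
move=> mf; apply: (@measurability _ _ _ _ _ _ (@open (strings N))) => //.
move=> _ [A oA <-]; rewrite setTI (open_bigcup_cylinder oA) preimage_bigcup.
apply: bigcup_measurable => n _; rewrite preimage_bigcup.
apply: fin_bigcup_measurable => // w _.
exact: (@forall_measurable _ _ 'I_n (fun k => [set x | f x k = tnth w k])).
Qed.

Lemma shift_measurable l : measurable_fun setT (iter l (@shift_map N)).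
Proof.
apply: measurable_strings_fun => k a.
rewrite (_ : [set x | _] = [set u : strings N | u (l + k)%N = a]); last first.
  by apply/seteqP; split => u /=; rewrite iter_shift.
apply: sub_sigma_algebra; rewrite openE => u /= <-; exact: coord_nbhs.
Qed.

Lemma continuous_strings_measurable {R : realType} (f : strings N -> R) :
  continuous f -> measurable_fun setT f.
Proof.
move=> /continuousP cf; apply: (measurability _ (measurable_realfun.RGenOpens.measurableE R)).
move=> _ [_ [a [b ->] <-]]; rewrite setTI; apply: sub_sigma_algebra.
exact/cf/interval_open.
Qed.

End strings_topology.

Section finite_valued.
Context {R : realType} d (T : measurableType d) (mu : probability T R).
Notation pr A := (fine (mu A)).

Lemma pr_ge0 A : 0 <= pr A.
Proof. exact: fine_ge0. Qed.

Lemma prE A : measurable A -> mu A = (pr A)%:E.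
Proof. by move=> mA; rewrite fineK// fin_num_measure. Qed.

Lemma pr_le A B : measurable A -> measurable B -> A `<=` B -> pr A <= pr B.
Proof. by move=> mA mB AB; rewrite fine_le ?fin_num_measure// le_measure// inE. Qed.

Lemma prU A B : measurable A -> measurable B -> pr (A `|` B) <= pr A + pr B.
Proof.
move=> mA mB; rewrite -fineD ?fin_num_measure//.
by rewrite fine_le ?fin_numD ?fin_num_measure ?measureU2//; exact: measurableU.
Qed.

(** For a finite [S] this is measurability for the discrete sigma-algebra, in a form that puts no
    structure on [S]. *)
Definition fibered (S : Type) (f : T -> S) := forall s, measurable (f @^-1` [set s]).

Lemma fibered_pred (S : finType) (f : T -> S) (P : set S) :
  fibered f -> measurable (f @^-1` P).
Proof.
move=> mf; rewrite (_ : _ @^-1` _ = \bigcup_(s in P) f @^-1` [set s]).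
  by apply: fin_bigcup_measurable => //; exact: finite_finset.
by apply/seteqP; split => [x Px|x [s Ps /= ->]]//; exists (f x).
Qed.

Lemma fibered_comp (S S' : finType) (f : T -> S) (g : S -> S') :
  fibered f -> fibered (fun x => g (f x)).
Proof. by move=> mf s; apply: (@fibered_pred _ f (g @^-1` [set s])). Qed.

Lemma fibered_pair (S S' : finType) (f : T -> S) (g : T -> S') :
  fibered f -> fibered g -> fibered (fun x => (f x, g x)).
Proof.
move=> mf mg [s s']; rewrite (_ : _ @^-1` _ = f @^-1` [set s] `&` g @^-1` [set s']).
  exact: measurableI.
by apply/seteqP; split => x /= [fx gx]; rewrite ?fx ?gx.
Qed.

Lemma fibered_tuple (S : finType) (n : nat) (f : 'I_n -> T -> S) :
  (forall i, fibered (f i)) -> fibered (fun x => [tuple f i x | i < n]).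
Proof.
move=> mf s; rewrite (_ : _ @^-1` _ = [set x | forall i, (f i @^-1` [set tnth s i]) x]).
  by apply: forall_measurable => i; exact: mf.
apply/seteqP; split => x /=; first by move=> <- k; rewrite tnth_mktuple.
by move=> h; apply: eq_from_tnth => k; rewrite tnth_mktuple.
Qed.

Definition fiber_law (S : Type) (f : T -> S) (s : S) : R := pr (f @^-1` [set s]).

Lemma fiber_law_ge0 (S : Type) (f : T -> S) s : 0 <= fiber_law f s.
Proof. exact: pr_ge0. Qed.

Lemma pr_setU_disj A B : measurable A -> measurable B -> A `&` B = set0 ->
  pr (A `|` B) = pr A + pr B.
Proof. by move=> mA mB AB; rewrite measureU// fineD// fin_num_measure. Qed.

Lemma pr_fibered (S : finType) (f : T -> S) (P : pred S) : fibered f ->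
  pr [set x | P (f x)] = \sum_(s | P s) fiber_law f s.
Proof.
move=> mf; rewrite -big_enum/=.
have : uniq (enum P) by exact: enum_uniq.
rewrite (_ : [set x | P (f x)] = [set x | f x \in enum P]); last first.
  by apply/seteqP; split => x /=; rewrite mem_enum.
elim: (enum P) => [_|s l IH /= /andP[sl ul]].
  rewrite big_nil (_ : [set x | _] = set0) ?measure0//.
  by apply/seteqP; split.
rewrite big_cons -IH// -pr_setU_disj//.
- congr (fine (mu _)); apply/seteqP; split => x /=; rewrite inE.
    by move=> /orP[/eqP|]; [left|right].
  by move=> [->|->]; rewrite ?eqxx ?orbT.
- exact: (fibered_pred [set s | s \in l] mf).
- by apply/seteqP; split => x //= [->]; rewrite (negbTE sl).
Qed.

Lemma sum_fiber_law (S : finType) (f : T -> S) : fibered f -> \sum_s fiber_law f s = 1.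
Proof.
move=> mf; rewrite -(pr_fibered xpredT)//.
by rewrite (_ : [set x | _] = setT) ?probability_setT//; apply/seteqP; split.
Qed.

Lemma fiber_law_comp (S S' : finType) (f : T -> S) (g : S -> S') (s : S') : fibered f ->
  fiber_law (fun x => g (f x)) s = \sum_(t | g t == s) fiber_law f t.
Proof.
move=> mf; rewrite -pr_fibered//; congr (fine (mu _)).
by apply/seteqP; split => x /= /eqP.
Qed.

Lemma sum_fiber_law_comp (S S' : finType) (f : T -> S) (g : S -> S') (y : S' -> R) : fibered f ->
  \sum_s fiber_law (fun x => g (f x)) s * y s = \sum_t fiber_law f t * y (g t).
Proof.
move=> mf; under eq_bigr do rewrite fiber_law_comp// mulr_suml.
rewrite (exchange_big_dep xpredT)//=; apply: eq_bigr => t _.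
by rewrite (big_pred1 (g t)) => [|s]; rewrite /= 1?eq_sym.
Qed.

End finite_valued.

(** * Approximation of Borel sets by cylinders *)

Section mixture.
Context {R : realType} d (T : measurableType d).

Lemma mixture (J : finType) (a : J -> R) (m : J -> probability T R) :
  (forall j, 0 <= a j) -> \sum_j a j = 1 ->
  exists rho : probability T R,
    forall A, measurable A -> rho A = (\sum_j a j * fine (m j A))%:E.
Proof.
move=> a0 a1.
have [j0 _] : exists j0 : J, true.
  apply/existsP; apply: contraT; rewrite negb_exists => /forallP T0.
  by move: a1; rewrite big1 => [/eqP|i _]; [rewrite eq_sym oner_eq0|have := T0 i].
pose e k := nth j0 (enum J) k.
pose M k := mscale (NngNum (a0 (e k))) (m (e k)).
have ME A : measurable A -> msum M #|J| A = (\sum_j a j * fine (m j A))%:E.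
  move=> mA; rewrite /msum.
  rewrite -(big_mkord xpredT (fun k => mscale (NngNum (a0 (e k))) (m (e k)) A)).
  rewrite cardE -(big_nth j0 xpredT (fun j => mscale (NngNum (a0 j)) (m j) A)).
  rewrite big_enum -sumEFin; apply: eq_bigr => j _.
  by rewrite /mscale/= EFinM fineK// fin_num_measure.
have MT : msum M #|J| setT = 1%E.
  rewrite ME//; congr EFin; rewrite -[RHS]a1; apply: eq_bigr => j _.
  by rewrite probability_setT mulr1.
(* The weighted sum has mass 1, so normalising leaves it unchanged and yields an element of
   [probability]; [m j0] is the default for a degenerate mass. *)
exists (mnormalize (msum M #|J|) (m j0)) => A mA.
rewrite /= /mnormalize; have -> : forall x, x = 1%E :> \bar R ->
    ((x == 0) || (x == +oo))%E = false by move=> x ->; rewrite eqe oner_eq0.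
  by rewrite [X in fine X](MT) [X in (X * _)%E](ME)//= invr1 mule1.
exact: MT.
Qed.

End mixture.

Lemma pr_le_sum {R : realType} d (T : measurableType d) (mu : probability T R)
    (J : finType) (A : set T) (B : J -> set T) :
  measurable A -> (forall j, measurable (B j)) -> A `<=` \bigcup_(j in setT) B j ->
  fine (mu A) <= \sum_j fine (mu (B j)).
Proof.
move=> mA mB AB; pose S (l : seq J) := [set x | exists2 j, j \in l & B j x].
have h l : measurable (S l) /\ fine (mu (S l)) <= \sum_(j <- l) fine (mu (B j)).
  elim: l => [|j l [mS IH]].
    by rewrite (_ : S _ = set0) ?measure0 ?big_nil//; apply/seteqP; split => x // [].
  have -> : S (j :: l) = B j `|` S l.
    apply/seteqP; split => [x [i]|x [jx|[i il ix]]].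
    - by rewrite inE => /orP[/eqP ->|il]; [left|right; exists i].
    - by exists j; rewrite ?mem_head.
    - by exists i; rewrite // inE il orbT.
  split; first exact: measurableU.
  by rewrite big_cons (le_trans (prU _ _ _))// lerD2l.
have [mS SB] := h (enum J); rewrite big_enum/= in SB; apply: le_trans SB.
by apply: pr_le => // x /AB[j _ jx]; exists j; rewrite ?mem_enum.
Qed.

Section approximation.
Context {R : realType} {N : nat}.
Notation I := 'I_N.+1.
Variable mu : probability (strings N) R.
Notation pr A := (fine (mu A)).

Lemma fibered_word s n : fibered (@word N s n).
Proof.
move=> w; rewrite (_ : _ @^-1` _ = iter s (@shift_map N) @^-1` cylinder w).
  rewrite -[X in measurable X]setTI; apply: shift_measurable => //.
  exact: cylinder_measurable.
by apply/seteqP; split => u /=; rewrite cylinderE word_iter_shift addn0.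
Qed.

Definition symdiff (T : Type) (A B : set T) := (A `\` B) `|` (B `\` A).

Definition approximable E := measurable E /\ forall e, 0 < e ->
  exists n (P : pred (n.-tuple I)), pr (symdiff E [set u | P (word 0 n u)]) <= e.

Lemma symdiff_measurable d (T : measurableType d) (A B : set T) :
  measurable A -> measurable B -> measurable (symdiff A B).
Proof. by move=> mA mB; apply: measurableU; exact: measurableD. Qed.

Lemma measurable_word_pred s n (P : pred (n.-tuple I)) :
  measurable [set u : strings N | P (word s n u)].
Proof. exact: (fibered_pred [set w | P w] (@fibered_word s n)). Qed.

Lemma approximable_lim E : measurable E ->
  (forall e, 0 < e -> exists2 E', approximable E' & pr (symdiff E E') <= e) ->
  approximable E.
Proof.
move=> mE h; split=> // e e0.
have [E' [mE' aE'] EE'] := h _ (divr_gt0 e0 (ltr0n _ 2)).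
have [n [P nP]] := aE' _ (divr_gt0 e0 (ltr0n _ 2)).
exists n, P; rewrite [e]splitr; apply: le_trans (lerD EE' nP).
set B := [set u | _].
have mB : measurable B by exact: measurable_word_pred.
apply: le_trans (prU _ _ _); [|exact: symdiff_measurable..].
apply: pr_le; [exact: symdiff_measurable|by apply: measurableU; exact: symdiff_measurable|].
move=> u [[Eu Bu]|[Bu Eu]]; have [E'u|E'u] := pselect (E' u).
- by right; left.
- by left; left.
- by left; right.
- by right; right.
Qed.

Lemma approximable_word n (P : pred (n.-tuple I)) : approximable [set u | P (word 0 n u)].
Proof.
split; first exact: measurable_word_pred.
move=> e e0; exists n, P.
by rewrite /symdiff setDv setU0 measure0 ltW.
Qed.

Lemma approximableC E : approximable E -> approximable (~` E).
Proof.
move=> [mE aE]; split; first exact: measurableC.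
move=> e /aE [n [P nP]]; exists n, (fun w => ~~ P w).
suff <- : symdiff E [set u | P (word 0 n u)] = symdiff (~` E) [set u | ~~ P (word 0 n u)] by [].
apply/seteqP; split => u [] [] /= h1 h2.
- by right; split; [exact/negP|move=> /(_ h1)].
- by left; split => //; apply/negP; rewrite negbK.
- by right; split; [apply: contrapT => /negP|].
- by left; split; [exact: contrapT|exact/negP].
Qed.

Lemma approximableU E F : approximable E -> approximable F -> approximable (E `|` F).
Proof.
move=> [mE aE] [mF aF]; split; first exact: measurableU.
move=> e e0.
have [n [P nP]] := aE _ (divr_gt0 e0 (ltr0n _ 2)).
have [m [Q mQ]] := aF _ (divr_gt0 e0 (ltr0n _ 2)).
pose r k (w : (maxn n m).-tuple I) := word 0 k (fill w).
have rn u : r n (word 0 (maxn n m) u) = word 0 n u.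
  by apply: word_le (word_fill _); rewrite leq_maxl.
have rm u : r m (word 0 (maxn n m) u) = word 0 m u.
  by apply: word_le (word_fill _); rewrite leq_maxr.
exists (maxn n m), (fun w => P (r n w) || Q (r m w)).
rewrite [e]splitr; apply: le_trans (lerD nP mQ).
apply: le_trans (prU _ _ _);
  [|by apply: symdiff_measurable => //; exact: measurable_word_pred..].
apply: pr_le; first apply: symdiff_measurable.
- exact: measurableU.
- exact: (@measurable_word_pred 0 _ (fun w => P (r n w) || Q (r m w))).
- by apply: measurableU; apply: symdiff_measurable => //; exact: measurable_word_pred.
move=> u; rewrite /symdiff /= rn rm => -[[[Eu|Fu] /negP]|[/orP[Pu|Qu] /not_orP[nE nF]]].
- by rewrite negb_or => /andP[/negP ? _]; left; left.
- by rewrite negb_or => /andP[_ /negP ?]; right; left.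
- by left; right.
- by right; right.
Qed.

(** Continuity of the measure along increasing finite unions reduces the claim to finite unions. *)
Lemma approximable_bigcup (E : (set (strings N))^nat) :
  (forall i, approximable (E i)) -> approximable (\bigcup_i E i).
Proof.
move=> aE.
have mE i : measurable (E i) by case: (aE i).
have mU : measurable (\bigcup_i E i) by exact: bigcupT_measurable.
pose F n := \big[setU/set0]_(i < n.+1) E i.
have aF n : approximable (F n).
  rewrite /F; elim: n => [|n IH]; first by rewrite big_ord1.
  by rewrite big_ord_recr; exact: approximableU.
have mF n : measurable (F n) by case: (aF n).
have UF : \bigcup_n F n = \bigcup_i E i.
  rewrite /F; exact: (bigcup_bigsetU_bigcup E).
have ndF : nondecreasing_seq F.
  by move=> m n mn; apply/subsetPset; exact: subset_bigsetU.
apply: approximable_lim => // e e0.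
have cF : pr (F n) @[n --> \oo] --> pr (\bigcup_i E i).
  apply: fine_cvg; rewrite fineK ?fin_num_measure//.
  by rewrite -UF; apply: nondecreasing_cvg_mu => //; rewrite UF.
have /cvgrPdist_le/(_ _ e0)[n _ /(_ n (leqnn n)) /= h] := cF.
exists (F n) => //; rewrite (_ : symdiff _ _ = \bigcup_i E i `\` F n); last first.
  rewrite /symdiff (_ : F n `\` _ = set0) ?setU0// -UF.
  by apply/seteqP; split => // u [Fu]; apply; exists n.
have FE : F n `<=` \bigcup_i E i by rewrite -UF => u Fu; exists n.
have := pr_setU_disj mu (mF n) (measurableD mU (mF n)).
rewrite setDIK setDUK// => /(_ erefl).
by have := ler_norm (pr (\bigcup_i E i) - pr (F n)); rewrite /comp /= in h *; lra.
Qed.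

(** The approximable sets form a sigma-algebra, and it contains the open sets because these are
    countable unions of cylinders. *)
Lemma measurable_approximable E : measurable E -> approximable E.
Proof.
apply: smallest_sub; first split.
- rewrite (_ : set0 = [set u | pred0 (word 0 0 u)]); last by apply/seteqP; split.
  exact: approximable_word.
- by move=> A aA; rewrite setTD; exact: approximableC.
- by move=> F aF; exact: approximable_bigcup.
move=> A /open_bigcup_cylinder ->; apply: approximable_bigcup => n.
rewrite (_ : \bigcup_(w in _) _ = [set u | `[< cylinder (word 0 n u) `<=` A >]]).
  exact: (@approximable_word n (fun w => `[< cylinder w `<=` A >])).
apply/seteqP; split => [u [w /= wA /cylinderE ->]|u /= /asboolP uA].
  exact/asboolP.
by exists (word 0 n u) => //; apply/cylinderE.
Qed.

(** Each fibre of [f] is approximated within [e / k.+1] by a set of words, and [g] picks any index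
    whose set contains the given word. Where [f] and [g] differ, [u] lies in the symmetric
    difference belonging to [f u] or in the one belonging to the index picked. *)
Lemma approx_partition (k : nat) (f : strings N -> 'I_k.+1) (e : R) :
  fibered f -> 0 < e ->
  exists n (g : n.-tuple I -> 'I_k.+1), pr [set u | f u != g (word 0 n u)] <= e.
Proof.
move=> mf e0; pose e' := e / k.+1%:R.
have e'0 : 0 < e' by rewrite divr_gt0.
have /choice[m] : forall j, exists m : {m : nat & pred (m.-tuple I)},
    pr (symdiff (f @^-1` [set j]) [set u | projT2 m (word 0 _ u)]) <= e'.
  move=> j; have [_ /(_ _ e'0)[n [P nP]]] := measurable_approximable (mf j).
  by exists (existT _ n P).
move=> mP; pose M := \max_j projT1 (m j).
pose Q (w : M.-tuple I) j := projT2 (m j) (word 0 _ (fill w)).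
have QE u j : Q (word 0 M u) j = projT2 (m j) (word 0 _ u).
  rewrite /Q (_ : word 0 (projT1 (m j)) _ = word 0 (projT1 (m j)) u)//.
  by apply: word_le (word_fill _); exact: (leq_bigmax j).
pose g w := odflt ord0 [pick j | Q w j].
exists M, g.
have mD j : measurable (symdiff (f @^-1` [set j]) [set u | projT2 (m j) (word 0 _ u)]).
  by apply: symdiff_measurable => //; exact: measurable_word_pred.
have sub : [set u | f u != g (word 0 M u)] `<=`
    \bigcup_(j in setT) symdiff (f @^-1` [set j]) [set u | projT2 (m j) (word 0 _ u)].
  move=> u /= fg; have [Qf|/negP Qf] := boolP (Q (word 0 M u) (f u)); last first.
    by exists (f u) => //; left; split => //=; rewrite -QE.
  exists (g (word 0 M u)) => //; right; split => /=; last exact/eqP.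
  by rewrite -QE /g; case: pickP => //= /(_ (f u)); rewrite Qf.
have mfg : measurable [set u | f u != g (word 0 M u)].
  pose h u := (f u, g (word 0 M u)).
  have mh : fibered h by apply: fibered_pair => //; apply: fibered_comp; exact: fibered_word.
  exact: (fibered_pred [set p | p.1 != p.2] mh).
have := pr_le_sum mu mfg mD sub => /le_trans; apply.
apply: (@le_trans _ _ (\sum_(j < k.+1) e')); first exact: ler_sum.
by rewrite sumr_const card_ord -mulr_natr /e' divfK// pnatr_eq0.
Qed.

End approximation.

(** One set of words must approximate [A] for both measures at once; an approximation for their
    half-half mixture [rho] does this. Any unbounded set [L] of lengths will do because a word
    determines its prefixes; it will be the multiples of a block length. *)
Lemma eq_measure_words {R : realType} {N : nat} (mu nu : probability (strings N) R) (L : set nat) :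
  (forall n, exists2 m, (n <= m)%N & L m) ->
  (forall n w, L n -> fiber_law mu (@word N 0 n) w = fiber_law nu (@word N 0 n) w) ->
  forall A, measurable A -> mu A = nu A.
Proof.
move=> Linf mn A mA.
have half0 : forall j : bool, 0 <= (2^-1 : R) by [].
have half1 : \sum_(j : bool) (2^-1 : R) = 1.
  by clear half0; rewrite big_bool /=; lra.
have [rho rhoE] := mixture (fun j : bool => if j then mu else nu) half0 half1.
clear half0 half1.
have le e : 0 < e -> `|fine (mu A) - fine (nu A)| <= e.
  move=> e0; have [_ /(_ _ (divr_gt0 e0 (ltr0n _ 2)))[n [P]]] := measurable_approximable rho mA.
  set B := [set u | _]; have mB : measurable B by exact: measurable_word_pred.
  have mD := symdiff_measurable mA mB.
  rewrite (rhoE _ mD) /= big_bool/= => h.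
  have muB : fine (mu B) = fine (nu B).
    have [m nm Lm] := Linf n.
    pose r (w : m.-tuple 'I_N.+1) := P (word 0 n (fill w)).
    have -> : B = [set u | r (word 0 m u)].
      by apply/seteqP; split => u; rewrite /B /r /= (word_le nm (word_fill _)).
    by rewrite !pr_fibered; try exact: fibered_word; apply: eq_bigr => w _; exact: mn.
  have diff (la : probability (strings N) R) :
      `|fine (la A) - fine (la B)| <= fine (la (symdiff A B)).
    rewrite ler_norml lerNl opprB !lerBlDl; apply/andP; split.
    - apply: le_trans (prU la mA mD); apply: pr_le => //; first exact: measurableU.
      by move=> u uB; have [|] := pselect (A u); [left|right; right].
    - apply: le_trans (prU la mB mD); apply: pr_le => //; first exact: measurableU.
      by move=> u uA; have [|] := pselect (B u); [left|right; left].
  have := diff mu; have := diff nu; rewrite muB.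
  move: (fine (mu A)) (fine (nu A)) (fine (nu B)) h => a b c h.
  rewrite !ler_norml => /andP[h1 h2] /andP[h3 h4]; apply/andP; split; lra.
rewrite (prE mu mA) (prE nu mA); congr EFin; apply/eqP; rewrite -subr_eq0 -normr_le0.
by apply/ler_addgt0Pl => e e0; rewrite addr0 le.
Qed.

(** * Integrals and the weak topology *)

Section integral.
Context {R : realType}.

Lemma bounded_integrable d (T : measurableType d) (mu : probability T R) (f : T -> R) (M : R) :
  measurable_fun setT f -> (forall x, `|f x| <= M) -> mu.-integrable setT (EFin \o f).
Proof.
move=> mf fM; apply: measurable_bounded_integrable => //.
  by rewrite -ge0_fin_numE// fin_num_measure.
exists M; split; first exact: num_real.
by move=> M' MM' x _; apply: (le_trans (fM x)); exact: ltW.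
Qed.

Lemma fibered_measurable_fun d (T : measurableType d) (S : finType) (f : T -> S) (c : S -> R) :
  fibered f -> measurable_fun setT (fun x => c (f x)).
Proof.
move=> mf _ A mA; rewrite setTI.
exact: (fibered_pred [set s | A (c s)] mf).
Qed.

Lemma fibered_integrable d (T : measurableType d) (mu : probability T R)
    (S : finType) (f : T -> S) (c : S -> R) :
  fibered f -> mu.-integrable setT (EFin \o (fun x => c (f x))).
Proof.
move=> mf; apply: (@bounded_integrable _ _ _ _ (\sum_s `|c s|)).
  exact: fibered_measurable_fun.
by move=> x; rewrite (bigD1 (f x))//= lerDl sumr_ge0.
Qed.

Lemma Rintegral_sum d (T : measurableType d) (mu : probability T R)
    (J : Type) (l : seq J) (h : J -> T -> R) :
  (forall j, mu.-integrable setT (EFin \o h j)) ->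
  mu.-integrable setT (EFin \o (fun x => \sum_(j <- l) h j x)) /\
  \int[mu]_x (\sum_(j <- l) h j x) = \sum_(j <- l) \int[mu]_x h j x.
Proof.
move=> ih; elim: l => [|j l [IH1 IH2]].
  rewrite big_nil; split.
    rewrite (_ : _ \o _ = cst 0%E); first exact: integrable0.
    by apply/funext => x /=; rewrite big_nil.
  under eq_Rintegral do rewrite big_nil.
  by rewrite Rintegral_cst// mul0r.
split.
  rewrite (_ : _ \o _ = (EFin \o h j) \+ (EFin \o (fun x => (\sum_(j <- l) h j x)%R)))%E.
    exact: integrableD.
  by apply/funext => x /=; rewrite big_cons.
rewrite big_cons -IH2 -RintegralD//.
by apply: eq_Rintegral => x _; rewrite big_cons.
Qed.

Lemma Rintegral_fibered d (T : measurableType d) (mu : probability T R)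
    (S : finType) (f : T -> S) (c : S -> R) : fibered f ->
  \int[mu]_x c (f x) = \sum_s fiber_law mu f s * c s.
Proof.
move=> mf.
pose ind s (t : S) : R := c s * (t == s)%:R.
have indE s : \int[mu]_x ind s (f x) = fiber_law mu f s * c s.
  rewrite /ind RintegralZl//; last exact: (fibered_integrable mu (fun t => (t == s)%:R)).
  rewrite mulrC; congr (_ * _).
  transitivity (fine (\int[mu]_x (\1_(f @^-1` [set s]) x)%:E)).
    congr fine; apply: eq_integral => x _; congr EFin; rewrite indicE.
    by congr (_%:R); congr nat_of_bool; apply/idP/idP; rewrite inE => /eqP.
  by rewrite integral_indic// setIT.
transitivity (\int[mu]_x (\sum_s ind s (f x))).
  apply: eq_Rintegral => x _; rewrite (bigD1 (f x))//= /ind eqxx mulr1 big1 ?addr0// => s.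
  by rewrite eq_sym => /negbTE ->; rewrite mulr0.
have [|_ ->] := @Rintegral_sum _ _ mu _ (index_enum S) (fun s x => ind s (f x)).
  by move=> s; exact: (fibered_integrable mu (ind s)).
by apply: eq_bigr => s _; exact: indE.
Qed.

Lemma continuous_integrable N (mu : probability (strings N) R) (f : strings N -> R) :
  continuous f -> mu.-integrable setT (EFin \o f).
Proof.
move=> cf; have [M fM] := continuous_bounded cf.
exact: bounded_integrable (continuous_strings_measurable cf) fM.
Qed.

Lemma Rintegral_approx N (mu : probability (strings N) R) (f : strings N -> R) (n : nat) (e : R) :
  continuous f -> (forall u v, word 0 n u = word 0 n v -> `|f u - f v| <= e) ->
  `|\int[mu]_u f u - \sum_w fiber_law mu (word 0 n) w * f (fill w)| <= e.
Proof.
move=> cf fe.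
have ig : mu.-integrable setT (EFin \o (fun u => f (fill (word 0 n u)))).
  exact: (fibered_integrable mu (fun w => f (fill w)) (@fibered_word N 0 n)).
have i_f := continuous_integrable mu cf.
rewrite -(Rintegral_fibered mu (fun w => f (fill w)) (@fibered_word N 0 n)).
rewrite -RintegralB//.
have ifg := integrableB measurableT i_f ig.
rewrite (le_trans (le_normr_Rintegral _ _))//.
have -> : e = \int[mu]_u (cst e u).
  have mT : fine (mu setT) = 1 by rewrite probability_setT.
  by rewrite Rintegral_cst// [X in _ * X]mT mulr1.
apply: le_Rintegral => //.
- exact: integrable_norm.
- by apply: (@bounded_integrable _ _ _ _ `|e|).
- by move=> u _; apply: fe; rewrite word_fill.
Qed.

End integral.

Section weak_topology.
Context {R : realType} {N : nat}.
Notation I := 'I_N.+1.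
Implicit Types mu nu : borel_prob R N.

(** Every weak neighbourhood of [mu] contains such a set, whose membership condition involves
    finitely many probabilities. *)
Definition close_words (mu : borel_prob R N) (n : nat) (d : R) : set (borel_prob R N) :=
  [set nu | forall w, `|fiber_law nu (@word N 0 n) w - fiber_law mu (word 0 n) w| <= d].

(** The cylinder of a word of length [n] is the union of those of its extensions, of which there are
    at most as many as words of length [m]; hence the divisor. *)
Lemma close_words_le mu n m d : (n <= m)%N -> 0 <= d ->
  close_words mu m (d / #|{: m.-tuple I}|%:R) `<=` close_words mu n d.
Proof.
move=> nm d0 nu h w.
pose r (v : m.-tuple I) : n.-tuple I := word 0 n (fill v).
have wE (la : probability (strings N) R) : fiber_law la (@word N 0 n) w =
    \sum_(v | r v == w) fiber_law la (word 0 m) v.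
  rewrite -(fiber_law_comp _ _ _ (@fibered_word N 0 m)).
  by congr (fine (la _)); apply/seteqP; split => u /=; rewrite /r (word_le nm (word_fill _)).
rewrite !wE.
rewrite -sumrB (le_trans (ler_norm_sum _ _ _))//.
rewrite (@le_trans _ _ (\sum_(v : m.-tuple I) d / #|{: m.-tuple I}|%:R))//.
  rewrite big_mkcond/=; apply: ler_sum => v _; case: ifP => // _.
  by rewrite divr_ge0.
rewrite sumr_const -[leLHS]mulr_natr divfK// pnatr_eq0 -lt0n.
by apply/card_gt0P; exists [tuple ord0 | _ < m].
Qed.

Definition words_filter mu : set_system (borel_prob R N) :=
  filter_from [set p : nat * R | 0 < p.2] (fun p => close_words mu p.1 p.2).

Instance words_filter_filter mu : Filter (words_filter mu).
Proof.
apply: filter_from_filter; first by exists (0%N, 1) => /=.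
move=> [n d] [m e] /= d0 e0.
pose k := maxn n m; pose b := Num.min d e.
have b0 : 0 < b by rewrite lt_min d0.
exists (k, b / #|{: k.-tuple I}|%:R).
  rewrite /= divr_gt0// ltr0n; apply/card_gt0P; exists [tuple ord0 | _ < k] => //.
move=> nu /= h; split.
- have := close_words_le (leq_maxl n m) (ltW b0) h => h' w.
  by rewrite (le_trans (h' w))// /b ge_min lexx.
- have := close_words_le (leq_maxr n m) (ltW b0) h => h' w.
  by rewrite (le_trans (h' w))// /b ge_min lexx orbT.
Qed.

Lemma words_filter_integral mu (f : strings N -> R) : continuous f ->
  (fun nu : borel_prob R N => \int[nu]_u f u) @ words_filter mu --> \int[mu]_u f u.
Proof.
move=> cf; apply/cvgrPdist_le => e e0.
have [n _ /(_ n (leqnn n)) ne] := continuous_word cf (divr_gt0 e0 (ltr0n _ 4)).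
pose M := \sum_(w : n.-tuple I) `|f (fill w)| + 1.
have M0 : 0 < M by rewrite ltr_wpDl// sumr_ge0.
(* Sampling [f] at words costs [e / 4] under either measure; exchanging the word laws costs [e / 2],
   since the sampled values have total size at most [M]. *)
exists (n, e / 2 / M); first by rewrite /= !divr_gt0.
move=> nu /= h.
have := Rintegral_approx mu cf ne; have := Rintegral_approx nu cf ne.
set a := \int[nu]_x _; set b := \int[mu]_x _; set s := BIG_F.
set sn := \sum_w _; set sm := \sum_w _ => h1 h2.
have h3 : `|sm - sn| <= e / 2.
  rewrite -sumrB (le_trans (ler_norm_sum _ _ _))//.
  rewrite (@le_trans _ _ (\sum_(w : n.-tuple I) e / 2 / M * `|f (fill w)|))//.
    by apply: ler_sum => w _; rewrite -mulrBl normrM ler_wpM2r// distrC h.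
  rewrite -mulr_sumr mulrAC ler_pdivrMr// ler_wpM2l ?divr_ge0// ?(ltW e0)//.
  by rewrite /M lerDl.
rewrite (_ : b - a = (b - sm) + (sm - sn) - (a - sn)); last by ring.
rewrite (le_trans (ler_normB _ _))// (le_trans (lerD (ler_normD _ _) (lexx _)))//.
move: h1 h2 h3; lra.
Qed.

(** In an initial topology convergence is tested after the defining map, here integral by integral,
    where [words_filter_integral] applies. *)
Lemma nbhs_borel_prob mu (A : set (borel_prob R N)) : nbhs mu A ->
  exists n, exists2 d, 0 < d & close_words mu n d `<=` A.
Proof.
move=> muA.
suff : words_filter mu --> mu.
  by move=> /(_ _ muA)[[n d] /= d0 ndA]; exists n, d.
move=> B /= [V [] [W oW WV] Vmu VB].
have : (fun nu : borel_prob R N => test_integrals nu) @ words_filter mu --> test_integrals mu.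
  apply/cvg_sup => f C /= [D [] [E oE ED] Dmu DC].
  have fc : continuous f by exact: cts_fun.
  have /(_ E) h := @words_filter_integral mu f fc; suff hD : words_filter mu ((@test_integrals R N) @^-1` D).
    by apply: (@filterS _ (words_filter mu) _ _ _ _ hD) => nu /= /DC.
  rewrite -ED; apply: h; apply: open_nbhs_nbhs; split => //.
  by rewrite -ED in Dmu.
move=> /(_ W) h; apply: filterS VB _; rewrite -WV.
apply: h; apply: open_nbhs_nbhs; split => //.
by rewrite -WV in Vmu.
Qed.

End weak_topology.

(** * Entropy of invariant measures *)

Section entropy_of_laws.
Context {R : realType} d (T : measurableType d) (mu : probability T R).

Lemma shannon_fiber_law_comp (S S' : finType) (f : T -> S) (g : S -> S') : fibered f ->
  shannon (fiber_law mu (fun x => g (f x))) <= shannon (fiber_law mu f).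
Proof.
move=> mf; apply: le_trans (shannon_map g (fiber_law_ge0 mu f)).
rewrite (_ : fiber_law mu _ = fun s => \sum_(t | g t == s) fiber_law mu f t)//.
by apply/funext => s; rewrite fiber_law_comp.
Qed.

Lemma fiber_law_pair_gt0 (S S' : finType) (f : T -> S) (g : T -> S') p :
  fibered f -> fibered g -> 0 < fiber_law mu (fun x => (f x, g x)) p ->
  0 < fiber_law mu f p.1 /\ 0 < fiber_law mu g p.2.
Proof.
move=> mf mg; have mfg := fibered_pair mf mg.
by split; (apply: lt_le_trans; first eassumption); apply: pr_le => // x /= <-.
Qed.

Lemma shannon_fiber_law_pair (S S' : finType) (f : T -> S) (g : T -> S') :
  fibered f -> fibered g ->
  shannon (fiber_law mu (fun x => (f x, g x))) <= shannon (fiber_law mu f) + shannon (fiber_law mu g).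
Proof.
move=> mf mg; have mfg := fibered_pair mf mg.
pose p := fiber_law mu (fun x => (f x, g x)).
have pE1 (y : S -> R) : \sum_s fiber_law mu f s * y s = \sum_t p t * y t.1.
  exact: (@sum_fiber_law_comp _ _ _ mu _ _ _ fst y mfg).
have pE2 (y : S' -> R) : \sum_s fiber_law mu g s * y s = \sum_t p t * y t.2.
  exact: (@sum_fiber_law_comp _ _ _ mu _ _ _ snd y mfg).
have := @gibbs _ _ p (fun t => fiber_law mu f t.1 * fiber_law mu g t.2) (fiber_law_ge0 mu _) (sum_fiber_law mu mfg).
move=> /(_ _ _ _)/le_trans; apply.
- by move=> t; rewrite mulr_ge0 ?fiber_law_ge0.
- rewrite -(pair_bigA _ (fun a b => fiber_law mu f a * fiber_law mu g b))/=.
  under eq_bigr do rewrite -mulr_sumr sum_fiber_law// mulr1.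
  by rewrite sum_fiber_law.
- by move=> t /(fiber_law_pair_gt0 mf mg)[? ?]; rewrite mulr_gt0.
rewrite /shannon -opprD pE1 pE2 -big_split/= lerN2; apply: ler_sum => t _.
rewrite -mulrDr.
have [pt0|pt0] := ltrP 0 (p t); last first.
  by rewrite (_ : p t = 0) ?mul0r//; apply/eqP; rewrite eq_le pt0 fiber_law_ge0.
have [? ?] := fiber_law_pair_gt0 mf mg pt0.
by rewrite lnM ?posrE.
Qed.

End entropy_of_laws.

Section invariant_entropy.
Context {R : realType} {N : nat}.
Notation I := 'I_N.+1.
Variable mu : borel_prob R N.
Hypothesis inv : shift_invariant mu.
Notation sh := (@shift_map N).

Lemma invariant_iter l (A : set (strings N)) : measurable A ->
  mu (iter l sh @^-1` A) = mu A.
Proof.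
elim: l A => // l IH A mA.
have m1 : measurable (sh @^-1` A).
  by rewrite -[X in measurable X]setTI; exact: (@shift_measurable N 1).
by rewrite -(inv mA) -(IH _ m1).
Qed.

Lemma fibered_shift (S : Type) (f : strings N -> S) l : fibered f ->
  fibered (fun u => f (iter l sh u)).
Proof.
move=> mf s; rewrite -[X in measurable X]setTI.
by apply: (@shift_measurable N l measurableT (f @^-1` [set s])).
Qed.

Lemma fiber_law_shift (S : Type) (f : strings N -> S) l : fibered f ->
  fiber_law mu (fun u => f (iter l sh u)) = fiber_law mu f.
Proof. by move=> mf; apply/funext => s; rewrite /fiber_law -(invariant_iter l (mf s)). Qed.

(** The itinerary of [u] of length [n] with respect to the partition into fibres of [f]. *)
Definition names (S : Type) (f : strings N -> S) n u : n.-tuple S :=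
  [tuple f (iter l sh u) | l < n].

Lemma fibered_names (S : finType) (f : strings N -> S) n : fibered f ->
  fibered (@names S f n).
Proof. by move=> mf; apply: fibered_tuple => i; exact: fibered_shift. Qed.

Lemma nth_names (S : Type) (f : strings N -> S) n u x0 k : (k < n)%N ->
  nth x0 (names f n u) k = f (iter k sh u).
Proof. by move=> kn; rewrite (nth_mktuple _ _ (Ordinal kn)). Qed.

Lemma word_names n : @word N 0 n = names (fun u => u 0%N) n.
Proof.
by apply/funext => u; apply: eq_from_tnth => i; rewrite !tnth_mktuple iter_shift addn0.
Qed.

(** A name of length [m + n] splits into one of length [m] and one of length [n] read after [m]
    shifts, which by invariance has the same law as an unshifted one. *)
Lemma shannon_names_subadd (S : finType) (f : strings N -> S) m n : fibered f ->
  shannon (fiber_law mu (names f (m + n))) <= shannon (fiber_law mu (names f m)) + shannon (fiber_law mu (names f n)).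
Proof.
move=> mf.
have mn := fibered_names (n:=n) mf; have mm := fibered_names (n:=m) mf.
rewrite -(fiber_law_shift m mn).
apply: le_trans (shannon_fiber_law_pair mu mm (fibered_shift m mn)).
pose g (p : m.-tuple S * n.-tuple S) : (m + n).-tuple S := [tuple of p.1 ++ p.2].
have -> : names f (m + n) = fun u => g (names f m u, names f n (iter m sh u)).
  apply/funext => u; apply: eq_from_tnth => i; rewrite tnth_mktuple.
  rewrite (tnth_nth (f u)) /= nth_cat (size_tuple (names f m u)).
  case: ltnP => im.
    by rewrite (nth_names _ _ _ im).
  by rewrite nth_names ?ltn_subLR// -iterD subnK.
exact: (shannon_fiber_law_comp mu g (fibered_pair mm (fibered_shift m mn))).
Qed.

Lemma names_cvg (S : finType) (f : strings N -> S) : fibered f ->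
  cvgn (fun n => n%:R^-1 * shannon (fiber_law mu (names f n))).
Proof.
move=> mf; apply: fekete => [n|m n]; last exact: shannon_names_subadd.
by apply: shannon_ge0; [exact: fiber_law_ge0|apply: sum_fiber_law; exact: fibered_names].
Qed.

(* Gibbs' inequality against the law of the random word obtained from the g-name by
   resampling each letter uniformly and independently with probability e. *)
Lemma shannon_names_noise (k : nat) (f g : strings N -> 'I_k.+1) (e : R) (n : nat) :
  fibered f -> fibered g -> 0 < e < 1 ->
  shannon (fiber_law mu (names f n)) <= shannon (fiber_law mu (names g n)) +
    n%:R * (- ln (1 - e) + fine (mu [set u | f u != g u]) * ln (k.+1%:R / e)).
Proof.
move=> mf mg /andP[e0 e1].
pose K : R := k.+1%:R.
have K0 : 0 < K by rewrite ltr0n.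
(* [kap (a, b)] is the probability that resampling turns [b] into [a]. *)
pose kap (p : 'I_k.+1 * 'I_k.+1) : R := (p.1 == p.2)%:R * (1 - e) + e / K.
have kap0 p : 0 < kap p.
  by rewrite /kap ltr_wpDl ?divr_gt0// mulr_ge0// subr_ge0 ltW.
have sum_kap b : \sum_a kap (a, b) = 1.
  rewrite /kap big_split/= sumr_const card_ord -[X in _ + X]mulr_natr divfK ?gt_eqF//.
  rewrite (bigD1 b)//= eqxx mul1r big1 ?addr0 ?subrK// => i /negbTE ->.
  by rewrite mul0r.
have mF := fibered_names (n:=n) mf; have mG := fibered_names (n:=n) mg.
have mFG := fibered_pair mF mG.
pose p := fiber_law mu (fun u => (names f n u, names g n u)).
have := shannon_fiber_law_comp mu fst mFG; move=> /le_trans; apply.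
pose q (t : n.-tuple 'I_k.+1 * n.-tuple 'I_k.+1) :=
  fiber_law mu (names g n) t.2 * \prod_i kap (tnth t.1 i, tnth t.2 i).
have := @gibbs _ _ p q (fiber_law_ge0 mu _) (sum_fiber_law mu mFG).
move=> /(_ _ _ _)/le_trans; apply.
- by move=> t; rewrite mulr_ge0 ?fiber_law_ge0// prodr_ge0// => i _; rewrite ltW.
- rewrite /q -(pair_bigA _ (fun a b => fiber_law mu (names g n) b * \prod_i kap (tnth a i, tnth b i)))/=.
  rewrite exchange_big/= -[leRHS](sum_fiber_law mu mG); apply: ler_sum => b _.
  have /= s1 := bigA_distr_tuple (fun i a => kap (a, tnth b i)).
  rewrite -mulr_sumr s1.
  by rewrite big1 ?mulr1// => i _; exact: sum_kap.
- move=> t /(fiber_law_pair_gt0 mF mG)[_ ?]; rewrite mulr_gt0//.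
  by rewrite prodr_gt0// => i _; exact: kap0.
have -> : - \sum_t p t * ln (q t) = shannon (fiber_law mu (names g n)) +
    - \sum_t p t * \sum_i ln (kap (tnth t.1 i, tnth t.2 i)).
  rewrite /shannon -opprD (@sum_fiber_law_comp _ _ _ mu _ _ _ snd (fun s => ln (fiber_law mu (names g n) s)) mFG).
  rewrite -big_split/=; congr (- _); apply: eq_bigr => t _; rewrite -mulrDr.
  have [pt0|pt0] := ltrP 0 (p t); last first.
    have pt : p t = 0 by apply/eqP; rewrite eq_le pt0 fiber_law_ge0.
    by rewrite /p in pt *; rewrite pt !mul0r.
  have [_ ?] := fiber_law_pair_gt0 mF mG pt0.
  by rewrite /q lnM ?posrE ?prodr_gt0// ln_prod.
rewrite lerD2l.
pose fg u := (f u, g u); have mfg : fibered fg by exact: fibered_pair.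
(* By invariance each of the [n] positions contributes the mean of [ln kap] at position 0. *)
have -> : \sum_t p t * \sum_i ln (kap (tnth t.1 i, tnth t.2 i)) =
    n%:R * \sum_s fiber_law mu fg s * ln (kap s).
  under eq_bigr do rewrite mulr_sumr.
  rewrite exchange_big/= mulr_natl -[n in RHS]card_ord -sumr_const; apply: eq_bigr => i _.
  rewrite -(fiber_law_shift i mfg).
  pose r (t : n.-tuple 'I_k.+1 * n.-tuple 'I_k.+1) := (tnth t.1 i, tnth t.2 i).
  rewrite -(@sum_fiber_law_comp _ _ _ mu _ _ _ r (fun s => ln (kap s)) mFG).
  apply: eq_bigr => s _; congr (_ * _); apply: (congr1 (fun h => fiber_law mu h s)).
  by apply/funext => u; rewrite /r /= !tnth_mktuple.
rewrite -mulrN ler_wpM2l//.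
rewrite (pr_fibered (f := fg) mu [pred s | s.1 != s.2])//=.
have c0 : 0 <= - ln (1 - e) by rewrite oppr_ge0 ln_le0// lerBlDr lerDl ltW.
rewrite -[X in X + _]mul1r -[X in _ <= X * _ + _](sum_fiber_law mu mfg) !mulr_suml -sumrN.
(* An agreeing pair costs at most [- ln (1 - e)], a disagreeing one exactly [ln (k.+1 / e)]. *)
rewrite [X in _ <= _ + X]big_mkcond -big_split/=; apply: ler_sum => s _.
rewrite -mulrN; case: ifPn => [ab|/negPn/eqP ab].
  rewrite -mulrDr ler_wpM2l ?fiber_law_ge0// /kap (negbTE ab) mul0r add0r.
  by rewrite -[leLHS]lnV ?posrE ?divr_gt0// invf_div lerDr.
rewrite addr0 ler_wpM2l ?fiber_law_ge0// lerN2 ler_ln ?posrE ?subr_gt0//.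
by rewrite /kap ab eqxx mul1r lerDl divr_ge0 ?ltW.
Qed.

End invariant_entropy.

(** * The Kolmogorov-Sinai theorem for the coordinate partition *)

Section kolmogorov_sinai.
Context {R : realType} {N : nat}.
Notation I := 'I_N.+1.
Notation sh := (@shift_map N).

Definition coord_entropy (mu : borel_prob R N) : R :=
  limn (fun n => n%:R^-1 * shannon (fiber_law mu (@word N 0 n))).

Variable mu : borel_prob R N.
Hypothesis inv : shift_invariant mu.

Lemma fibered_coord : fibered (fun u : strings N => u 0%N).
Proof.
move=> a; rewrite (_ : _ @^-1` _ = cylinder [tuple a | _ < 1]).
  exact: cylinder_measurable.
apply/seteqP; split => u; first by move=> ua k; rewrite tnth_mktuple ord1.
by move/(_ ord0); rewrite tnth_mktuple.
Qed.

Lemma coord_entropy_cvg : (fun n => n%:R^-1 * shannon (fiber_law mu (@word N 0 n))) @ \oo --> coord_entropy mu.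
Proof.
have := names_cvg inv fibered_coord.
by rewrite /coord_entropy (_ : (fun n => _) = (fun n => n%:R^-1 * shannon (fiber_law mu (@word N 0 n))))//;
  apply/funext => n; rewrite word_names.
Qed.

Lemma coord_entropy_le : coord_entropy mu <= ln N.+1%:R.
Proof.
apply: (limr_le (cvgP _ coord_entropy_cvg)); near=> n.
have n0 : (0 < n)%N by near: n; exists 1%N.
rewrite mulrC ler_pdivrMr ?ltr0n//.
have := shannon_le_card (fiber_law_ge0 mu _) (sum_fiber_law mu (@fibered_word N 0 n)).
by rewrite card_tuple card_ord natrX lnXn ?ltr0n// mulr_natr.
Unshelve. all: by end_near. Qed.

(** The first [n + r] letters determine the name of length [n], and the [r] extra letters add at
    most an amount of entropy that stays fixed as [n] grows. *)
Lemma shannon_names_word (S : finType) r (g : r.-tuple I -> S) n :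
  shannon (fiber_law mu (names (fun u => g (word 0 r u)) n)) <=
  shannon (fiber_law mu (@word N 0 n)) + shannon (fiber_law mu (@word N 0 r)).
Proof.
rewrite !word_names.
apply: le_trans (shannon_names_subadd inv n r fibered_coord).
pose F (w : (n + r).-tuple I) : n.-tuple S := [tuple g (word l r (fill w)) | l < n].
rewrite (_ : names _ n = fun u => F (word 0 (n + r) u)).
  rewrite -word_names; exact: (shannon_fiber_law_comp mu F (@fibered_word N 0 (n + r))).
apply/funext => u; apply: eq_from_tnth => l; rewrite !tnth_mktuple /=.
congr g; rewrite -word_names; apply/eq_wordP => k kr; rewrite iter_shift add0n.
have lk : (l + k < n + r)%N.
  by apply: (@leq_ltn_trans (l + r)); rewrite ?leq_add2l ?ltn_add2r// ltnW.
by rewrite /fill (nth_mktuple _ _ (Ordinal lk)).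
Qed.

(** Replace [f] by a function [g] of [r] letters that errs with small probability. The entropy per
    step rises by at most [e], split into [e / 2] for the noise level [d], [e / 4] for the errors of
    [g] and [e / 4] for the extra letters. *)
Lemma names_le_coord_entropy (k : nat) (f : strings N -> 'I_k.+1) : fibered f ->
  limn (fun n => n%:R^-1 * shannon (fiber_law mu (names f n))) <= coord_entropy mu.
Proof.
move=> mf; apply/ler_addgt0Pr => e e0.
have [d /andP[d0 d1] de] : exists2 d : R, 0 < d < 1 & - ln (1 - d) <= e / 2.
  (* The solution of [- ln (1 - d) = e / 2]. *)
  exists (1 - expR (- (e / 2))).
    rewrite subr_gt0 expR_lt1 oppr_lt0 divr_gt0//=.
    by rewrite ltrBlDl ltrDr expR_gt0.
  by rewrite opprB addrCA subrr addr0 expRK opprK.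
pose L := ln (k.+1%:R / d) + 1.
have L0 : 0 < L.
  rewrite ltr_wpDl// ln_ge0// ler_pdivlMr// mul1r (le_trans (ltW d1))//.
  by rewrite ler1n.
have [r [g gL]] := approx_partition mu mf (divr_gt0 (divr_gt0 e0 (ltr0n _ 4)) L0).
have mg : fibered (fun u => g (word 0 r u)) by apply: fibered_comp; exact: fibered_word.
have main n : shannon (fiber_law mu (names f n)) <=
    shannon (fiber_law mu (@word N 0 n)) + shannon (fiber_law mu (@word N 0 r)) + n%:R * (e / 2 + e / 4).
  have d01 : 0 < d < 1 by rewrite d0.
  apply: (le_trans (shannon_names_noise inv n mf mg d01)); apply: lerD.
    exact: shannon_names_word.
  rewrite ler_wpM2l// lerD//.
  move: gL; rewrite ler_pdivlMr// => /(le_trans _); apply.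
  by rewrite ler_wpM2l// ?pr_ge0// /L lerDl.
apply: (@le_trans _ _ (limn (fun n => n%:R^-1 * shannon (fiber_law mu (@word N 0 n)) + e))).
  apply: ler_lim; first exact: names_cvg.
    by apply: is_cvgD; [exact: (cvgP _ coord_entropy_cvg)|exact: is_cvg_cst].
  near=> n.
  have n0 : 0 < n%:R :> R by rewrite ltr0n; near: n; exists 1%N.
  have nr : shannon (fiber_law mu (@word N 0 r)) <= n%:R * (e / 4).
    by rewrite -ler_pdivrMr ?divr_gt0//; near: n; exact: nbhs_infty_ger.
  rewrite mulrC ler_pdivrMr// mulrDl mulrAC mulVf ?gt_eqF// mul1r.
  by have := main n; lra.
rewrite limD; [|exact: (cvgP _ coord_entropy_cvg)|exact: is_cvg_cst].
by rewrite lim_cst.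
Unshelve. all: by end_near. Qed.

Lemma join_entropyE (k : nat) (A : 'I_k -> set (strings N)) (f : strings N -> 'I_k) n :
  (forall j, A j = f @^-1` [set j]) ->
  join_entropy sh mu A n = shannon (fiber_law mu (names f n)).
Proof.
move=> Af; congr (- _); apply: eq_bigr => w _.
rewrite /fiber_law (_ : join_atom _ _ _ = names f n @^-1` [set w])//.
apply/seteqP; split => u /=.
  by move=> h; apply: eq_from_tnth => l; have := h l; rewrite Af tnth_mktuple.
by move=> <- l; rewrite Af tnth_mktuple.
Qed.

(** Any measurable partition consists of the fibres of its index map, to which
    [names_le_coord_entropy] applies; the coordinate partition attains the supremum. *)
Lemma entropyE : entropy sh mu = (coord_entropy mu)%:E.
Proof.
apply/eqP; rewrite eq_le; apply/andP; split.
  apply: ge_ereal_sup => _ [k [A [[mA tA AT] ->]]].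
  have ex u : exists j, A j u.
    have [j _ ju] : (\bigcup_j A j) u by rewrite AT.
    by exists j.
  case: k A mA tA AT ex => [|k] A mA tA AT ex; first by have [[]] := ex point.
  have [f fA] := choice ex.
  have Af j : A j = f @^-1` [set j].
    apply/seteqP; split => u /= ju; last by rewrite -ju.
    by apply: (tA (f u) j) => //; exists u.
  have mf : fibered f by move=> j; rewrite -Af.
  rewrite /entropy_partition (eq_fun (fun n => congr1 (fun x => (n%:R^-1 * x)%:E) (join_entropyE n Af))).
  by rewrite EFin_lim ?lee_fin; [exact: names_le_coord_entropy|exact: names_cvg].
apply: ereal_sup_ubound; exists N.+1, (fun j => [set u | u 0%N = j]); split.
  split.
  - exact: fibered_coord.
  - by move=> i j _ _ [u [/= <- <-]].
  - by apply/seteqP; split => // u _; exists (u 0%N).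
rewrite /entropy_partition (eq_fun (fun n => congr1 (fun x => (n%:R^-1 * x)%:E) (join_entropyE n (fun=> erefl)))).
rewrite EFin_lim; last exact: (names_cvg inv fibered_coord).
by congr (limn _)%:E; apply/funext => n; rewrite word_names.
Qed.

End kolmogorov_sinai.

Lemma shannon_word_mixture {R : realType} {N : nat} (J : finType) (a : J -> R)
    (m : J -> borel_prob R N) (rho : borel_prob R N) :
  (forall j, 0 <= a j) -> \sum_j a j = 1 ->
  (forall A, measurable A -> rho A = (\sum_j a j * fine (m j A))%:E) ->
  forall n, \sum_j a j * shannon (fiber_law (m j) (@word N 0 n)) <= shannon (fiber_law rho (@word N 0 n)).
Proof.
move=> a0 a1 rhoE n.
have -> : fiber_law rho (@word N 0 n) = (fun w => \sum_j a j * fiber_law (m j) (@word N 0 n) w).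
  by apply/funext => w; rewrite /fiber_law rhoE//; exact: fibered_word.
apply: shannon_mix => // [j t|j]; first exact: fiber_law_ge0.
by apply: sum_fiber_law; exact: fibered_word.
Qed.

(** * Independent blocks *)

Lemma fibered_ffun d (T : measurableType d) (I S : finType) (f : I -> T -> S) :
  (forall i, fibered (f i)) -> fibered (fun x => [ffun i => f i x]).
Proof.
move=> mf s; rewrite (_ : _ @^-1` _ = [set x | forall i, (f i @^-1` [set s i]) x]).
  by apply: forall_measurable => i; exact: mf.
apply/seteqP; split => x /=; first by move=> <- k; rewrite ffunE.
by move=> h; apply/ffunP => k; rewrite ffunE.
Qed.

(* Coding of [0, 1[ by the expanding map sending each interval [start t, start t + p t[
   affinely onto [0, 1[; the code digits are independent with law p. *)
Section iid.
Context {R : realType} (T : finType) (p : T -> R).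
Hypotheses (p0 : forall t, 0 <= p t) (p1 : \sum_t p t = 1).

Let start (t : T) : R := \sum_(s | (enum_rank s < enum_rank t)%N) p s.
Let here (x : R) (t : T) : bool := start t <= x < start t + p t.

Lemma start_ge0 t : 0 <= start t.
Proof. exact: sumr_ge0. Qed.

Lemma start_lt s t : (enum_rank s < enum_rank t)%N -> start s + p s <= start t.
Proof.
move=> st; rewrite /start [leRHS](bigD1 s)//= [leLHS]addrC lerD2l.
rewrite [leLHS]big_mkcond [leRHS]big_mkcond; apply: ler_sum => i _.
case: ifP => // lis; last by case: ifP.
rewrite (ltn_trans lis st); case: eqP => [ei|_] //=.
by move: lis; rewrite ei ltnn.
Qed.

Lemma start_le1 t : start t + p t <= 1.
Proof.
rewrite -p1 (bigD1 t)//= [leLHS]addrC lerD2l [leLHS]big_mkcond [leRHS]big_mkcond.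
apply: ler_sum => i _; case: ifP => // it; last by case: ifP.
by case: eqP it => [->|//]; rewrite ltnn.
Qed.

Lemma here_inj x s t : here x s -> here x t -> s = t.
Proof.
move=> /andP[s1 s2] /andP[t1 t2]; apply: enum_rank_inj; apply: ord_inj.
case: (ltngtP (enum_rank s) (enum_rank t)) => // /start_lt h; exfalso.
  by have := lt_le_trans s2 (le_trans h t1); rewrite ltxx.
by have := lt_le_trans t2 (le_trans h s1); rewrite ltxx.
Qed.

Variable t0 : T.
Let letter (x : R) : T := odflt t0 [pick t | here x t].
Let expand (x : R) : R := (x - start (letter x)) / p (letter x).

Definition digit (k : nat) (x : R) : T := letter (iter k expand x).

Lemma letterE x t : here x t -> letter x = t.
Proof.
by move=> xt; rewrite /letter; case: pickP => [s xs|/(_ t)]; [exact: here_inj xt|rewrite xt].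
Qed.

(** The left end of the interval coded by the digits [b]; its length is the product of the [p t]. *)
Let left (b : seq T) : R := foldr (fun t l => start t + p t * l) 0 b.

Lemma left_bounds b : 0 <= left b /\ left b + \prod_(t <- b) p t <= 1.
Proof.
elim: b => [|t b [IH1 IH2]] /=; first by rewrite big_nil add0r.
rewrite addr_ge0 ?mulr_ge0 ?start_ge0// big_cons -addrA -mulrDr; split => //.
by apply: le_trans (start_le1 t); rewrite lerD2l ler_piMr.
Qed.

(** Induction on [b]: [expand] carries the interval of [t :: b] onto that of [b]. *)
Lemma digit_left b x : left b <= x < left b + \prod_(t <- b) p t ->
  forall k, (k < size b)%N -> digit k x = nth t0 b k.
Proof.
elim: b x => // t b IH x; rewrite /= big_cons => /andP[x1 x2].
have [lb0 lb1] := left_bounds b.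
have Pb0 : 0 <= \prod_(t <- b) p t by exact: prodr_ge0.
(* The interval of [t :: b] contains [x], so it has positive length and [expand] divides by a
   nonzero number. *)
have pt0 : 0 < p t.
  rewrite lt_neqAle p0 andbT; apply/eqP => pt.
  by move: x1 x2; rewrite -pt !mul0r !addr0 => x1; rewrite ltNge x1.
have xt : here x t.
  apply/andP; split; first by rewrite (le_trans _ x1)// lerDl mulr_ge0.
  rewrite (lt_le_trans x2)// -addrA lerD2l -mulrDr.
  by rewrite ler_piMr.
have ex : left b <= expand x < left b + \prod_(t <- b) p t.
  rewrite /expand (letterE xt) ler_pdivlMr// ltr_pdivrMr//.
  rewrite lerBrDl mulrC x1/= ltrBlDl mulrDl addrA mulrC.
  by rewrite [X in _ < _ + X]mulrC.
case=> [_|k kb]; first exact: letterE.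
rewrite /digit iterSr /=; exact: IH.
Qed.

Lemma fibered_letter : fibered letter.
Proof.
pose g (b : {ffun T -> bool}) := odflt t0 [pick t | b t].
have -> : letter = fun x => g [ffun t => here x t].
  apply/funext => x; rewrite /g /letter; congr odflt.
  by apply: eq_pick => t; rewrite ffunE.
apply: fibered_comp; apply: fibered_ffun => t b.
have mt : measurable [set x | here x t].
  rewrite (_ : [set x | _] = `[start t, start t + p t[%classic); first exact: measurable_itv.
  by apply/seteqP; split => x /=; rewrite in_itv.
case: b; first exact: mt.
rewrite (_ : _ @^-1` _ = ~` [set x | here x t]); first exact: measurableC.
by apply/seteqP; split => x /=; case: (here x t).
Qed.

Lemma measurable_expand : measurable_fun setT expand.
Proof.
apply: measurable_realfun.measurable_funM.
  apply: measurable_realfun.measurable_funB; first exact: measurable_id.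
  exact: (fibered_measurable_fun start fibered_letter).
exact: (fibered_measurable_fun (fun t => (p t)^-1) fibered_letter).
Qed.

Lemma fibered_digit k : fibered (digit k).
Proof.
have mi : measurable_fun setT (iter k expand).
  elim: k => [|k IH]; first exact: measurable_id.
  exact: (measurableT_comp measurable_expand IH).
move=> t; rewrite -[X in measurable X]setTI.
exact: (mi measurableT (letter @^-1` [set t]) (fibered_letter t)).
Qed.

Definition unit_law : probability (measurableTypeR R) R := uniform_prob (@ltr01 R).

Lemma unit_law_itv (a b : R) : 0 <= a -> 0 <= b -> a + b <= 1 ->
  unit_law `[a, (a + b)[%classic = b%:E.
Proof.
move=> a0 b0 ab; rewrite /unit_law /= /uniform_prob integral_uniform_pdf.
rewrite setIidl; last first.
  move=> x /=; rewrite !in_itv/= => /andP[h1 h2].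
  by rewrite (le_trans a0 h1) (le_trans (ltW h2)).
rewrite (eq_integral (cst 1%E)).
  rewrite integral_cst//= mul1e lebesgue_measure_itv/= lte_fin ltrDl.
  by case: ltgtP b0 => // [b0 _|<- _]; rewrite // -EFinD addrAC subrr add0r.
move=> x; rewrite inE/= in_itv/= => /andP[h1 h2].
by rewrite /uniform_pdf (le_trans a0 h1) (le_trans (ltW h2))// subr0 invr1.
Qed.

(** The interval coded by [b] shows that the law of the digits gives [b] at least the mass
    [prodp p b]. Both sides have total mass 1, so these inequalities are equalities. *)
Lemma digits_law K :
  fiber_law unit_law (fun x => [ffun i : 'I_K => digit i x]) = @prodp R T p K.
Proof.
have mD : fibered (fun x => [ffun i : 'I_K => digit i x]).
  by apply: fibered_ffun => i; exact: fibered_digit.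
have le b : prodp p b <= fiber_law unit_law (fun x => [ffun i : 'I_K => digit i x]) b.
  pose s := [seq b i | i <- enum 'I_K].
  have [s0 s1] := left_bounds s.
  have Ps : \prod_(t <- s) p t = prodp p b by rewrite big_map big_enum.
  rewrite Ps in s1.
  have -> : prodp p b = fine (unit_law `[left s, (left s + prodp p b)[%classic).
    by rewrite unit_law_itv// prodp_ge0.
  apply: pr_le; [exact: measurable_itv|exact: mD|].
  move=> x /=; rewrite in_itv/= -Ps => /digit_left h.
  have sE : size s = K by rewrite size_map -cardE card_ord.
  apply/ffunP => i; rewrite ffunE h ?sE//.
  by rewrite (nth_map i) ?nth_ord_enum// -cardE card_ord.
apply/funext => b; apply/esym/eqP.
have : \sum_b (fiber_law unit_law (fun x => [ffun i : 'I_K => digit i x]) b - prodp p b) = 0.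
  by rewrite sumrB sum_fiber_law// sum_prodp// subrr.
move=> /psumr_eq0P h; rewrite -subr_eq0 -oppr_eq0 opprB h// => i _.
by rewrite subr_ge0.
Qed.

End iid.

Lemma image_law {R : realType} d (T : measurableType d) d' (T' : measurableType d')
    (P : probability T R) (f : T -> T') : measurable_fun setT f ->
  exists Q : probability T' R, forall A, Q A = P (f @^-1` A).
Proof.
move=> mf.
pose F : {mfun T >-> T'} := HB.pack f (isMeasurableFun.Build _ _ _ _ _ mf).
by exists (distribution P F).
Qed.

Section prodp_tail.
Context {R : realType} (T : finType) (p : T -> R).
Hypotheses (p0 : forall t, 0 <= p t) (p1 : \sum_t p t = 1).

(** Forgetting the first of [K.+1] independent letters leaves independent letters; this will make
    the block process invariant under a shift by one whole block. *)
Lemma prodp_tail K (b : {ffun 'I_K -> T}) :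
  \sum_(c : {ffun 'I_K.+1 -> T} | [ffun i => c (lift ord0 i)] == b) prodp p c = prodp p b.
Proof.
pose F (i : 'I_K.+1) t := p t * if unlift ord0 i is Some j then (t == b j)%:R else 1.
transitivity (\sum_(c : {ffun 'I_K.+1 -> T}) \prod_i F i (c i)).
  rewrite big_mkcond; apply: eq_bigr => c _.
  rewrite /F big_split/= [X in _ * X]big_ord_recl unlift_none mul1r.
  under [X in _ * X]eq_bigr do rewrite liftK.
  case: eqP => [<-|cb].
    by rewrite [X in _ * X]big1 ?mulr1// => i _; rewrite ffunE eqxx.
  have [j cj] : exists j, c (lift ord0 j) != b j.
    apply/existsP; apply: contra_notT cb; rewrite negb_exists => /forallP h.
    by apply/ffunP => j; rewrite ffunE; apply/eqP; have := h j; rewrite negbK.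
  by rewrite [X in _ * X](bigD1 j)//= (negbTE cj) mul0r mulr0.
rewrite -(bigA_distr_bigA F) big_ord_recl.
have -> : \sum_t F ord0 t = 1.
  by rewrite -[RHS]p1; apply: eq_bigr => t _; rewrite /F unlift_none mulr1.
rewrite [LHS]mul1r; apply: eq_bigr => i _; rewrite /F liftK.
rewrite (bigD1 (b i))//= eqxx mulr1 big1 ?addr0// => t.
by move=> /negbTE ->; rewrite mulr0.
Qed.

End prodp_tail.

Section blocks.
Context {R : realType} {N n : nat}.
Notation I := 'I_N.+1.
Notation sh := (@shift_map N).
Hypothesis n0 : (0 < n)%N.

Definition blocks (s K : nat) (u : strings N) : {ffun 'I_K -> n.-tuple I} :=
  [ffun i : 'I_K => word (s + i * n) n u].

Lemma fibered_blocks s K : fibered (blocks s K).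
Proof. by apply: fibered_ffun => i; exact: fibered_word. Qed.

Lemma eq_blocks s s' K u v :
  blocks s K u = blocks s' K v <-> word s (K * n) u = word s' (K * n) v.
Proof.
split=> [/ffunP h|/eq_wordP h].
  apply/eq_wordP => k kn; have kK : (k %/ n < K)%N by rewrite ltn_divLR.
  have := h (Ordinal kK); rewrite !ffunE => /eq_wordP/(_ (k %% n)%N (ltn_pmod _ n0)) /=.
  by rewrite -!addnA -divn_eq.
apply/ffunP => i; rewrite !ffunE; apply/eq_wordP => k kn.
rewrite -!addnA h// (@leq_trans (i.+1 * n))//; first by rewrite mulSn addnC ltn_add2r.
by rewrite leq_mul2r ltn_ord orbT.
Qed.

Variable p : n.-tuple I -> R.
Hypotheses (p0 : forall w, 0 <= p w) (p1 : \sum_w p w = 1).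

Lemma iid_blocks : exists nu : borel_prob R N, forall K,
  fiber_law nu (blocks 0 K) = @prodp R _ p K.
Proof.
pose t0 : n.-tuple I := [tuple ord0 | _ < n].
(* The digits are themselves words of length [n], written one after the other. *)
pose phi x : strings N := fun j => nth ord0 (digit p t0 (j %/ n) x) (j %% n).
have mphi : @measurable_fun _ _ (measurableTypeR R) (strings N) setT phi.
  apply: measurable_strings_fun => k a.
  have := fibered_pred [set w : n.-tuple I | nth ord0 w (k %% n) = a] (fibered_digit p t0 (k %/ n)).
  exact.
have [nu nuE] := image_law (@unit_law R) mphi.
exists nu => K; rewrite -(digits_law p0 p1 t0 K).
apply/funext => b; rewrite /fiber_law nuE; congr (fine (unit_law _)).
suff bE x : blocks 0 K (phi x) = [ffun i : 'I_K => digit p t0 i x].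
  by apply/seteqP; split => x /=; rewrite bE.
apply/ffunP => i; rewrite !ffunE; apply: eq_from_tnth => k.
rewrite tnth_word add0n /phi divnMDl// divn_small// addn0 modnMDl modn_small//.
by rewrite (tnth_nth ord0).
Qed.

(** The block process [nu] is invariant under [n] shifts, so its average [mu] over [n] consecutive
    shifts is invariant under one. For the entropy, a window of length [K.+1 * n] starting anywhere
    in the first block contains the [K] whole blocks that follow it, and by concavity averaging over
    the starting points keeps this bound. *)
Lemma block_measure : exists mu nu : borel_prob R N,
  [/\ shift_invariant mu,
      forall A, measurable A ->
        mu A = (\sum_(j < n) n%:R^-1 * fine (nu (iter j sh @^-1` A)))%:E,
      fiber_law nu (word 0 n) = p &
      n%:R^-1 * shannon p <= coord_entropy mu].
Proof.
have [nu nuE] := iid_blocks.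
have nuS K : fiber_law nu (blocks n K) = @prodp R _ p K.
  apply/funext => b; rewrite -(prodp_tail p1 b) -nuE.
  rewrite -(fiber_law_comp nu (fun c : {ffun 'I_K.+1 -> n.-tuple I} => [ffun i => c (lift ord0 i)]) b (@fibered_blocks 0 K.+1)).
  apply: (congr1 (fun f => fiber_law nu f b)); apply/funext => u; apply/ffunP => i.
  by rewrite !ffunE /= add0n /bump leq0n mulSn.
have image j := image_law nu (@shift_measurable N j).
have /choice[m mE] := image.
(* By [prodp_tail] the blocks from position [n] on have the same law as those from position 0; words
   whose length is a multiple of [n] then determine the measure. *)
have nS0 : forall A, measurable A -> m n A = nu A.
  apply: (@eq_measure_words _ _ _ _ [set (K * n)%N | K in setT]).
    by move=> k; exists (k * n)%N; [rewrite leq_pmulr|exists k].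
  move=> k w [K _ Kn]; subst k.
  have h s : [set u | word s (K * n) u = w] = blocks s K @^-1` [set blocks 0 K (fill w)].
    by apply/seteqP; split => u /=; rewrite eq_blocks word_fill.
  rewrite /fiber_law mE.
  have -> : iter n sh @^-1` (word 0 (K * n) @^-1` [set w]) = [set u | word n (K * n) u = w].
    by apply/seteqP; split => u /=; rewrite word_iter_shift addn0.
  rewrite h [X in _ = fine (nu X)](h 0%N).
  exact: (congr1 (fun f => f (blocks 0 K (fill w))) (etrans (nuS K) (esym (nuE K)))).
have nS A : measurable A -> nu (iter n sh @^-1` A) = nu A by move=> mA; rewrite -mE nS0.
have nR : n%:R != 0 :> R by rewrite pnatr_eq0 -lt0n.
have a0 : forall j : 'I_n, 0 <= n%:R^-1 :> R by move=> _; rewrite invr_ge0.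
have a1 : \sum_(j < n) n%:R^-1 = 1 :> R.
  by rewrite sumr_const card_ord -[LHS]mulr_natr mulVf.
have [mu muE] := mixture (fun j : 'I_n => m j) a0 a1.
exists mu, nu.
have muE' A : measurable A ->
    mu A = (\sum_(j < n) n%:R^-1 * fine (nu (iter j sh @^-1` A)))%:E.
  by move=> mA; rewrite muE//; congr EFin; apply: eq_bigr => j _; rewrite mE.
have inv : shift_invariant mu.
  move=> A mA.
  have mSA : measurable (sh @^-1` A).
    by rewrite -[X in measurable X]setTI; exact: (@shift_measurable N 1).
  rewrite !muE'//; congr EFin; rewrite -!mulr_sumr; congr (_ * _).
  pose F j := fine (nu (iter j sh @^-1` A)).
  (* The two sums differ by the terms at [n] and at 0, which agree by the invariance of [nu] under
     [n] shifts. *)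
  have FE : \sum_(j < n) F j.+1 = \sum_(j < n) F j.
    apply: (@addrI _ (F 0%N)).
    rewrite -(big_ord_recl n (fun j : 'I_n.+1 => F j)) big_ord_recr/= addrC.
    by rewrite /F nS.
  rewrite -[RHS]FE; apply: eq_bigr => j _; rewrite /F; congr (fine (nu _)).
split => //.
  apply/funext => w.
  have := congr1 (fun f => f [ffun=> w]) (nuE 1%N).
  rewrite /prodp big_ord1 ffunE => <-; congr (fine (nu _)).
  apply/seteqP; split => u /=.
    by move=> uw; apply/ffunP => i; rewrite !ffunE ord1 mul0n addn0.
  by move/ffunP => /(_ ord0); rewrite !ffunE mul0n addn0.
have HK K : K%:R * shannon p <= shannon (fiber_law mu (@word N 0 (K.+1 * n))).
  apply: le_trans (shannon_word_mixture a0 a1 muE _).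
  rewrite -[leLHS]mul1r -[X in X * _ <= _]a1 mulr_suml; apply: ler_sum => j _.
  rewrite ler_wpM2l// -(shannon_prodp K p0 p1) -nuS.
  have -> : fiber_law (m j) (@word N 0 (K.+1 * n)) = fiber_law nu (word j (K.+1 * n)).
    apply/funext => w; rewrite /fiber_law mE; congr (fine (nu _)).
    by apply/seteqP; split => u /=; rewrite word_iter_shift addn0.
  pose G (w : (K.+1 * n).-tuple I) := blocks (n - j) K (fill w).
  rewrite (_ : blocks n K = fun u => G (word j (K.+1 * n) u)).
    exact: (shannon_fiber_law_comp nu G (@fibered_word N j (K.+1 * n))).
  apply/funext => u; rewrite /G; apply/eq_blocks/eq_wordP => k kn.
  have jn : (j <= n)%N by exact: ltnW.
  have lt : (n - j + k < K.+1 * n)%N.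
    by rewrite mulSn; move: (K * n)%N kn => M kn; lia.
  rewrite /fill (nth_mktuple _ _ (Ordinal lt))/=; congr (u _).
  by rewrite addnA subnKC.
clear a0 a1.
have hc := coord_entropy_cvg inv.
have nR0 : 0 < n%:R :> R by rewrite ltr0n.
rewrite mulrC ler_pdivrMr// mulrC.
apply/ler_addgt0Pr => e e0.
have e1 : 0 < e / 2 / n%:R by rewrite !divr_gt0.
have /cvgrPdist_le/(_ _ e1)[k0 _ k0P] := hc.
(* [L] is the price of the one block in [K.+1] that is lost; [K] is so large that this is at most
   [e / 2] per block and that the entropy per letter is near its limit. *)
pose L := n%:R * (coord_entropy mu) + e / 2.
pose B := Num.bound (2 * `|L| / e).
pose K := (maxn k0 B).+1.
have KR : 0 < K%:R :> R by rewrite ltr0n.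
have kK : (k0 <= K.+1 * n)%N.
  by rewrite (leq_trans _ (leq_pmulr _ n0))// /K; apply: leq_trans (leq_maxl k0 B) _; lia.
have := k0P _ kK; rewrite /= ler_norml => /andP[h _].
have KnR : 0 < (K.+1 * n)%:R :> R by rewrite ltr0n muln_gt0.
have h2 : shannon (fiber_law mu (word 0 (K.+1 * n))) <= (K.+1 * n)%:R * (coord_entropy mu + e / 2 / n%:R).
  by rewrite -ler_pdivrMl//; move: h; rewrite lerNl opprB lerBlDl.
have h3 := le_trans (HK K) h2.
have h4 : (K.+1 * n)%:R * (coord_entropy mu + e / 2 / n%:R) = K%:R * L + L.
  by rewrite /L natrM -natr1; field.
have h5 : L <= K%:R * (e / 2).
  have : 2 * `|L| / e <= K%:R.
    have x0 : 0 <= 2 * `|L| / e by rewrite divr_ge0 ?mulr_ge0// ltW.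
    apply: (le_trans (ltW (archi_boundP x0))).
    by rewrite ler_nat /K; apply: leq_trans (leq_maxr k0 B) _.
  rewrite ler_pdivrMr// => h6.
  by have := ler_norm L; lra.
rewrite h4 in h3.
have : K%:R * shannon p <= K%:R * (n%:R * coord_entropy mu + e).
  by apply: (le_trans h3); rewrite /L in h5 *; lra.
by rewrite ler_pM2l.
Qed.

End blocks.

(** * Convexity of the ratio *)

Section convexity.
Context {R : realType} {X : normedModType R} (C : set X).
Hypothesis convC : convex_set (C : set (convex_lmodType X)).

Lemma convex_setE (x y : X) (s : R) : 0 <= s <= 1 -> C x -> C y ->
  C (s *: x + (1 - s) *: y).
Proof.
move=> /andP[s0 s1] Cx Cy.
have := convC (x := x) (y := y) (Itv01 s0 s1).
by rewrite !inE; exact.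
Qed.

(** The map [g] undoes the contraction towards [y], as [z = s *: g z + (1 - s) *: y]. It is
    continuous and sends the point in question to [x], so near that point [g z] lies in [C], and
    hence so does [z]. *)
Lemma convex_interior (x y : X) (s : R) : 0 < s <= 1 -> C° x -> C y ->
  C° (s *: x + (1 - s) *: y).
Proof.
move=> /andP[s0 s1] Cx Cy.
pose g (z : X) := s^-1 *: (z - (1 - s) *: y).
have gx : g (s *: x + (1 - s) *: y) = x.
  by rewrite /g addrK scalerA mulVf ?scale1r// gt_eqF.
have cg : {for (s *: x + (1 - s) *: y), continuous g}.
  by apply: cvgZ; [exact: cvg_cst|apply: cvgB; [exact: cvg_id|exact: cvg_cst]].
have := cg C; rewrite gx => /(_ Cx) h.
suff : nbhs (s *: x + (1 - s) *: y) C by [].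
apply: (@filterS _ _ _ (g @^-1` C)) h => z Cz.
have := convex_setE (s := s) _ Cz Cy.
rewrite /g scalerA divff ?gt_eqF// scale1r subrK; apply.
by rewrite ltW.
Qed.

End convexity.

Lemma mixture2 {R : realType} d (T : measurableType d) (mu nu : probability T R) (t : R) :
  0 <= t <= 1 -> exists rho : probability T R, forall A, measurable A ->
    (rho A = t%:E * mu A + (1 - t)%:E * nu A)%E.
Proof.
move=> /andP[t0 t1].
have a0 (b : bool) : 0 <= if b then t else 1 - t by case: b; rewrite ?subr_ge0.
have a1 : \sum_(b : bool) (if b then t else 1 - t) = 1 by rewrite big_bool/= addrC subrK.
have [rho rhoE] := mixture (fun b : bool => if b then mu else nu) a0 a1.
exists rho => A mA.
by rewrite rhoE// big_bool/= EFinD !EFinM !fineK// fin_num_measure.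
Qed.

Section ratio.
Context {R : realType} {N : nat} {X : normedModType R}.
Variables (Gamma : borel_prob R N -> X) (Delta : borel_prob R N -> R).
Hypotheses (affG : affine_prob Gamma)
  (affD : affine_prob (Delta : borel_prob R N -> R^o))
  (D0 : forall mu, Delta mu != 0).
Let U := fun mu : borel_prob R N => (Delta mu)^-1 *: Gamma mu.

(** For values [a] and [b] of opposite signs, the mixture with weight [b / (b - a)] would have
    [Delta] equal to 0. *)
Lemma Delta_same_sign mu nu : 0 < Delta mu * Delta nu.
Proof.
rewrite lt_neqAle eq_sym mulf_neq0//= leNgt; apply/negP => neg.
pose a := Delta mu; pose b := Delta nu.
have neg' : a * b < 0 by [].
have ab : 0 < (b - a) * b.
  rewrite (_ : _ * b = b ^+ 2 - a * b); last by ring.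
  by rewrite subr_gt0 (lt_le_trans neg')// sqr_ge0.
have ba : 0 < (b - a) * - a.
  rewrite (_ : _ * - a = a ^+ 2 - a * b); last by ring.
  by rewrite subr_gt0 (lt_le_trans neg')// sqr_ge0.
have ba0 : b - a != 0 by apply: contraTneq ab => ->; rewrite mul0r ltxx.
have sq : 0 < (b - a) ^+ 2 by rewrite exprn_even_gt0.
have t01 : 0 <= b / (b - a) <= 1.
  rewrite (_ : b / (b - a) = ((b - a) * b) / (b - a) ^+ 2); last by field.
  rewrite divr_ge0 ?(ltW ab) ?(ltW sq)//= ler_pdivrMr// mul1r.
  by rewrite -subr_ge0 (_ : _ - _ = (b - a) * - a) ?(ltW ba)//; ring.
have [rho rhoE] := mixture2 mu nu t01.
have := affD t01 rhoE; rewrite -/a -/b /= => rho0.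
have := D0 rho; rewrite rho0 => /eqP; apply.
by rewrite /GRing.scale/=; field.
Qed.

(** The new weight is [s = t * Delta mu / Delta rho], which lies in the unit interval because all
    values of [Delta] have the same sign. That it is positive with [t] is what later moves values
    into the interior of [C]. *)
Lemma U_mix (t : R) (mu nu rho : borel_prob R N) : 0 <= t <= 1 ->
  (forall A, measurable A -> rho A = t%:E * mu A + (1 - t)%:E * nu A)%E ->
  exists2 s, 0 <= s <= 1 /\ (0 < t -> 0 < s) & U rho = s *: U mu + (1 - s) *: U nu.
Proof.
move=> t01 rhoE; have /andP[t0 t1] := t01.
have Dr : Delta rho = t * Delta mu + (1 - t) * Delta nu by exact: (affD t01 rhoE).
have Gr := affG t01 rhoE.
have mr := Delta_same_sign mu rho; have nr := Delta_same_sign nu rho.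
have rr : 0 < Delta rho ^+ 2 by rewrite exprn_even_gt0// D0.
have sE : t * Delta mu / Delta rho = t * (Delta mu * Delta rho) / Delta rho ^+ 2.
  by field; exact: D0.
have sE' : 1 - t * Delta mu / Delta rho = (1 - t) * Delta nu / Delta rho.
  rewrite -[X in X - _](divff (D0 rho)) -mulrBl; congr (_ / _); rewrite Dr; ring.
exists (t * Delta mu / Delta rho).
  split; last by move=> t'; rewrite sE divr_gt0// mulr_gt0.
  apply/andP; split; first by rewrite sE divr_ge0 ?(ltW rr)// mulr_ge0// ltW.
  rewrite -subr_ge0 sE' (_ : _ * _ / _ = (1 - t) * (Delta nu * Delta rho) / Delta rho ^+ 2).
    by rewrite divr_ge0 ?(ltW rr)// mulr_ge0 ?subr_ge0// ltW.
  by field; exact: D0.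
rewrite sE' /U Gr scalerDr !scalerA; congr (_ *: _ + _ *: _).
  by field; rewrite !D0.
by field; rewrite !D0.
Qed.

Variable C : set X.
Hypothesis convC : convex_set (C : set (convex_lmodType X)).

(** Induction splits off the last measure. The weights are left unnormalised so that the first [k]
    satisfy the same hypotheses. A value in [C] is asked for only where the weight is positive,
    whence the separate cases of a vanishing weight. *)
Lemma U_mix_nat (a : nat -> R) (m : nat -> borel_prob R N) k (rho : borel_prob R N) :
  (forall i, 0 <= a i) -> 0 < \sum_(i < k) a i ->
  (forall i, (i < k)%N -> 0 < a i -> C (U (m i))) ->
  (forall A, measurable A ->
     rho A = ((\sum_(i < k) a i * fine (m i A)) / \sum_(i < k) a i)%:E) ->
  C (U rho).
Proof.
move=> a0; elim: k rho => [|k IH] rho; first by rewrite big_ord0 ltxx.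
set s := \sum_(i < k.+1) a i => s0 aC rhoE.
pose s' := \sum_(i < k) a i.
have sE : s = s' + a k by rewrite /s big_ord_recr.
have bin (mu nu : borel_prob R N) t : 0 <= t <= 1 -> C (U mu) -> C (U nu) ->
    (forall A, measurable A -> fine (rho A) = t * fine (mu A) + (1 - t) * fine (nu A)) ->
    C (U rho).
  move=> t01 Cm Cn E.
  have [|r [r01 _] ->] := @U_mix t mu nu rho t01; last exact: convex_setE.
  move=> A mA; rewrite (prE rho mA) E// EFinD !EFinM.
  by congr (_ * _ + _ * _)%E; rewrite fineK// fin_num_measure.
have s'0 : 0 <= s' by exact: sumr_ge0.
have [s'z|s'n] := eqVneq s' 0.
  have ak : 0 < a k by move: s0; rewrite sE s'z add0r.
  have Ck := aC k (leqnn _) ak.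
  apply: (bin _ _ 1 _ Ck Ck) => [|A mA]; first by rewrite ler01 lexx.
  rewrite subrr mul0r addr0 mul1r rhoE//= big_ord_recr/= big1 ?add0r.
    by rewrite sE s'z add0r mulrAC divff ?mul1r// gt_eqF.
  move=> i _; suff -> : a i = 0 by rewrite mul0r.
  apply/eqP; rewrite eq_le a0 andbT -s'z /s' (bigD1 i)//= lerDl.
  exact: sumr_ge0.
have s'gt : 0 < s' by rewrite lt_neqAle eq_sym s'n.
have b0 (i : 'I_k) : 0 <= a i / s' by rewrite divr_ge0.
have b1 : \sum_(i < k) a i / s' = 1 by rewrite -mulr_suml divff.
have [rho' rhoE'] := mixture (fun i : 'I_k => m i) b0 b1.
have Cr : C (U rho').
  apply: IH => // [i ik|A mA]; first by apply: aC; rewrite ltnS ltnW.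
  rewrite rhoE'// mulr_suml; congr EFin; apply: eq_bigr => i _.
  by rewrite mulrAC.
have rhoR A : measurable A -> fine (rho A) = s' / s * fine (rho' A) + a k / s * fine (m k A).
  move=> mA; rewrite rhoE// rhoE'//= big_ord_recr/= mulrDl mulr_sumr mulr_suml; congr (_ + _).
    by apply: eq_bigr => i _; field; rewrite !gt_eqF.
  by rewrite mulrAC.
have t01 : 0 <= s' / s <= 1.
  by rewrite divr_ge0 ?(ltW s0)//= ler_pdivrMr// mul1r sE lerDl.
have tE : 1 - s' / s = a k / s by rewrite -[1](@divff _ s) ?gt_eqF// -mulrBl sE addrAC subrr add0r.
have [ak|ak] := ltrP 0 (a k).
  by apply: (bin _ _ _ t01 Cr (aC k (leqnn _) ak)) => A mA; rewrite tE rhoR.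
have ak0 : a k = 0 by apply/eqP; rewrite eq_le ak a0.
apply: (bin _ _ _ t01 Cr Cr) => A mA.
by rewrite rhoR// tE ak0 !mul0r.
Qed.

Lemma U_mixture (J : finType) (a : J -> R) (m : J -> borel_prob R N) (rho : borel_prob R N) :
  (forall j, 0 <= a j) -> \sum_j a j = 1 ->
  (forall j, 0 < a j -> C (U (m j))) ->
  (forall A, measurable A -> rho A = (\sum_j a j * fine (m j A))%:E) ->
  C (U rho).
Proof.
move=> a0 a1 aC rhoE.
have [j0 _] : exists j0 : J, true.
  apply/existsP; apply: contraT; rewrite negb_exists => /forallP T0.
  by move: a1; rewrite big1 => [/eqP|i _]; [rewrite eq_sym oner_eq0|have := T0 i].
pose e k := nth j0 (enum J) k.
have sumE (F : J -> R) : \sum_(i < #|J|) F (e i) = \sum_j F j.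
  by rewrite -(big_mkord xpredT (fun k => F (e k))) cardE -(big_nth j0 xpredT F) big_enum.
apply: (@U_mix_nat (a \o e) (m \o e) #|J|) => //=.
- by rewrite sumE a1.
- by move=> i _; exact: aC.
- by move=> A mA; rewrite (sumE a) a1 divr1 (sumE (fun j => a j * fine (m j A))) rhoE.
Qed.

End ratio.

(** * Upper bound for the partition sums *)

Section birkhoff.
Context {R : realType} {N : nat}.
Notation I := 'I_N.+1.
Notation sh := (@shift_map N).
Implicit Types (phi : strings N -> R).

Lemma birkhoff_sumS phi n u :
  birkhoff_sum phi n.+1 u = phi u + birkhoff_sum phi n (sh u).
Proof.
rewrite /birkhoff_sum big_ord_recl; congr (_ + _).
by apply: eq_bigr => i _; rewrite lift0 iterSr.
Qed.

(** If two strings share [n] letters, their [k]-th shifts share [n - k]. So all but at most [r]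
    terms differ by at most [e / 2], and the others cost [2 * M] each, which is negligible against
    [n]. *)
Lemma birkhoff_variation phi (e : R) : continuous phi -> 0 < e ->
  \forall n \near \oo, forall u v, word 0 n u = word 0 n v ->
    `|birkhoff_sum phi n u - birkhoff_sum phi n v| <= n%:R * e.
Proof.
move=> cphi e0.
have [M phiM] := continuous_bounded cphi.
have M0 : 0 <= M by apply: le_trans (phiM point).
have [r _ rP] := continuous_word cphi (divr_gt0 e0 (ltr0n _ 2)).
have bound n u v : word 0 n u = word 0 n v ->
    `|birkhoff_sum phi n u - birkhoff_sum phi n v| <= n%:R * (e / 2) + 2 * M * (minn n r)%:R.
  elim: n u v => [|n IH] u v uv.
    by rewrite /birkhoff_sum !big_ord0 subrr normr0 min0n mulr0 mul0r addr0.
  rewrite !birkhoff_sumS opprD addrACA (le_trans (ler_normD _ _))//.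
  have suv : word 0 n (sh u) = word 0 n (sh v).
    apply/eq_wordP => k kn; move/eq_wordP : uv => /(_ k.+1).
    by rewrite ltnS /shift_map add0n; exact.
  have nE : n.+1%:R * (e / 2) = e / 2 + n%:R * (e / 2) by rewrite -natr1; ring.
  rewrite nE; have [rn|rn] := boolP (r <= n.+1)%N.
    rewrite -addrA lerD ?(rP _ rn)// (le_trans (IH _ _ suv))// lerD2l.
    by rewrite ler_wpM2l ?mulr_ge0// ler_nat; lia.
  have -> : minn n.+1 r = (minn n r).+1 by lia.
  have := le_trans (ler_normB (phi u) (phi v)) (lerD (phiM u) (phiM v)).
  rewrite (_ : 2 * M * _ = 2 * M * (minn n r)%:R + 2 * M); last by rewrite -natr1; ring.
  by have := IH _ _ suv; have := e0; lra.
near=> n => u v uv; apply: (le_trans (bound _ _ _ uv)).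
have : 2 * M * (minn n r)%:R <= n%:R * (e / 2).
  apply: (@le_trans _ _ (2 * M * r%:R)).
    by rewrite ler_wpM2l ?mulr_ge0// ler_nat geq_minr.
  by rewrite -ler_pdivrMr ?divr_gt0//; near: n; exact: nbhs_infty_ger.
lra.
Unshelve. all: by end_near. Qed.

Lemma birkhoff_bounded phi n : continuous phi ->
  exists M, forall u, `|birkhoff_sum phi n u| <= M.
Proof.
move=> /continuous_bounded[M phiM]; exists (\sum_(k < n) M) => u.
by rewrite (le_trans (ler_norm_sum _ _ _))//; apply: ler_sum.
Qed.

Lemma sup_cylinder phi n (w : n.-tuple I) : continuous phi ->
  let s := sup [set expR (birkhoff_sum phi n u) | u in cylinder w] in
  (forall u, cylinder w u -> expR (birkhoff_sum phi n u) <= s) /\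
  (forall b, (forall u, cylinder w u -> expR (birkhoff_sum phi n u) <= b) -> s <= b).
Proof.
move=> cphi s; have [M phiM] := birkhoff_bounded n cphi.
split=> [u wu|b wb].
  apply: ub_le_sup; last by exists u.
  exists (expR M) => _ [v _ <-]; rewrite ler_expR.
  by rewrite (le_trans (ler_norm _)).
apply: ge_sup => [|_ [u wu <-]]; last exact: wb.
by exists (expR (birkhoff_sum phi n (fill w))), (fill w) => //; apply/cylinderE/word_fill.
Qed.

Lemma empirical_fine n u (A : set (strings N)) : (0 < n)%N ->
  fine (empirical R n u A) = n%:R^-1 * \sum_(k < n) (iter k sh u \in A)%:R.
Proof.
case: n => // n _; rewrite empiricalE; under eq_bigr do rewrite diracE.
by rewrite sumEFin.
Qed.

Lemma fiber_law_empirical n u (S : eqType) (f : strings N -> S) s : (0 < n)%N ->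
  fiber_law (empirical R n u) f s = n%:R^-1 * \sum_(k < n) (f (iter k sh u) == s)%:R.
Proof.
move=> n0; rewrite /fiber_law empirical_fine//; congr (_ * _); apply: eq_bigr => k _.
by congr (_%:R); congr nat_of_bool; apply/idP/idP; rewrite inE => /eqP.
Qed.

End birkhoff.

Section upper_bound.
Context {R : realType} {N : nat} {X : normedModType R}.
Notation I := 'I_N.+1.
Notation sh := (@shift_map N).
Variables (Gamma : borel_prob R N -> X) (Delta : borel_prob R N -> R).
Hypotheses (cG : continuous Gamma) (affG : affine_prob Gamma)
  (cD : continuous Delta)
  (affD : affine_prob (Delta : borel_prob R N -> R^o))
  (D0 : forall mu, Delta mu != 0).
Let U := fun mu : borel_prob R N => (Delta mu)^-1 *: Gamma mu.

Lemma U_continuous : continuous U.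
Proof.
move=> mu.
have FF : Filter (nbhs (mu : borel_prob R N)) by exact: nbhs_filter.
apply: (@cvgZ _ _ _ _ FF (fun mu => (Delta mu)^-1) Gamma); last exact: cG.
by apply: cvgV; [exact: D0|exact: cD].
Qed.

Variable C : set X.
Hypotheses (clC : closed C) (convC : convex_set (C : set (convex_lmodType X))).

Section block.
Variables (n : nat) (mu nu : borel_prob R N).
Hypotheses (n0 : (0 < n)%N)
  (muE : forall A, measurable A ->
        mu A = (\sum_(j < n) n%:R^-1 * fine (nu (iter j sh @^-1` A)))%:E).

Lemma fiber_law_average q c :
  fiber_law mu (@word N 0 q) c = \sum_(j < n) n%:R^-1 * fiber_law nu (@word N j q) c.
Proof.
rewrite {1}/fiber_law muE//; last exact: fibered_word.
apply: eq_bigr => j _; congr (_ * fine (nu _)).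
by apply/seteqP; split => u /=; rewrite word_iter_shift addn0.
Qed.

(** A word of length [n + q] contains all [n] windows of length [q] that the average over shifts
    looks at. *)
Lemma sum_fiber_law_average q (y : q.-tuple I -> R) :
  \sum_c fiber_law mu (@word N 0 q) c * y c =
  \sum_(v : (n + q).-tuple I) fiber_law nu (@word N 0 (n + q)) v *
     (n%:R^-1 * \sum_(j < n) y (word j q (fill v))).
Proof.
under eq_bigr do rewrite fiber_law_average mulr_suml.
under [RHS]eq_bigr do rewrite mulr_sumr mulr_sumr.
rewrite exchange_big [RHS]exchange_big/=; apply: eq_bigr => j _.
under eq_bigr do rewrite -mulrA.
under [RHS]eq_bigr do rewrite mulrCA.
rewrite -!mulr_sumr; congr (_ * _).
rewrite -(@sum_fiber_law_comp _ _ _ nu _ _ (@word N 0 (n + q)) (fun v => word j q (fill v)))//; last exact: fibered_word.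
apply: eq_bigr => c _; congr (_ * _); apply: (congr1 (fun f => fiber_law nu f c)).
apply/funext => u; apply/eq_wordP => k kq.
have lt : (j + k < n + q)%N by apply: (@leq_trans (j + q)); rewrite ?ltn_add2l// leq_add2r ltnW.
by rewrite /fill (nth_mktuple _ _ (Ordinal lt)).
Qed.

Lemma fiber_law_prefix_le K (v : (n + K).-tuple I) :
  fiber_law nu (@word N 0 (n + K)) v <= fiber_law nu (@word N 0 n) (word 0 n (fill v)).
Proof.
apply: pr_le; [exact: fibered_word|exact: fibered_word|move=> u /= <-].
by apply/esym; apply: word_le (word_fill _); rewrite leq_addr.
Qed.

(** If [U mu] were outside the closed set [C], then for some [q] so would be [U] of every measure
    whose law of words of length [q] is close to that of [mu]. But the mixture [rho] of the
    empirical measures of words of length [n + q] drawn from [nu] has exactly the law of [mu] on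
    these words, while [U rho] lies in [C] by convexity. *)
Lemma block_U_in : (forall w, 0 < fiber_law nu (@word N 0 n) w ->
    forall u, cylinder w u -> C (U (empirical R n u))) -> C (U mu).
Proof.
move=> h; apply: contrapT => nC.
have oC : open (U @^-1` (~` C)).
  by apply: open_comp => [mu' _|]; [exact: U_continuous|exact: closed_openC].
have /nbhs_borel_prob[q [d d0 qd]] : nbhs mu (U @^-1` (~` C)) by apply: open_nbhs_nbhs.
pose a (v : (n + q).-tuple I) := fiber_law nu (@word N 0 (n + q)) v.
have a0 v : 0 <= a v by exact: fiber_law_ge0.
have a1 : \sum_v a v = 1 by apply: sum_fiber_law; exact: fibered_word.
have [rho rhoE] := mixture (fun v => empirical R n (fill v)) a0 a1.
apply: (qd rho).
  move=> c; rewrite (_ : fiber_law rho _ c = fiber_law mu (word 0 q) c); first by rewrite subrr normr0 ltW.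
  transitivity (\sum_c' fiber_law mu (@word N 0 q) c' * (c' == c)%:R); last first.
    rewrite (bigD1 c)//= eqxx mulr1 big1 ?addr0// => i /negbTE ->.
    by rewrite mulr0.
  rewrite (sum_fiber_law_average (fun c' => (c' == c)%:R)) {1}/fiber_law rhoE; last exact: fibered_word.
  apply: eq_bigr => v _; congr (_ * _).
  rewrite -[LHS]/(fiber_law (empirical R n (fill v)) (word 0 q) c) fiber_law_empirical//.
  by congr (_ * _); apply: eq_bigr => j _; rewrite word_iter_shift addn0.
apply: (U_mixture affG affD D0 convC a0 a1 _ rhoE) => v av.
apply: (h (word 0 n (fill v))).
  exact: lt_le_trans av (fiber_law_prefix_le v).
exact/cylinderE.
Qed.

(** Up to a small error [phi] is a function of [q] letters; its integral is then a mean, over words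
    of length [n + q] drawn from [nu], of Birkhoff averages over [n] steps, and each is bounded
    below through the first [n] letters. *)
Lemma block_integral_ge (phi : strings N -> R) (c : n.-tuple I -> R) : continuous phi ->
  (forall w u, 0 < fiber_law nu (@word N 0 n) w -> cylinder w u -> c w <= birkhoff_sum phi n u) ->
  n%:R^-1 * \sum_w fiber_law nu (@word N 0 n) w * c w <= \int[mu]_u phi u.
Proof.
move=> cphi h; apply/ler_addgt0Pr => e e0.
have [q _ /(_ q (leqnn q)) qP] := continuous_word cphi (divr_gt0 e0 (ltr0n _ 2)).
have := Rintegral_approx mu cphi qP.
rewrite sum_fiber_law_average ler_norml => /andP[+ _].
set Sg := \sum_v _ => I1.
have nR : 0 < n%:R :> R by rewrite ltr0n.
suff : n%:R^-1 * \sum_w fiber_law nu (@word N 0 n) w * c w - e / 2 <= Sg by move: I1; lra.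
have -> : \sum_w fiber_law nu (@word N 0 n) w * c w =
    \sum_(v : (n + q).-tuple I) fiber_law nu (@word N 0 (n + q)) v * c (word 0 n (fill v)).
  rewrite -(@sum_fiber_law_comp _ _ _ nu _ _ (@word N 0 (n + q)) (fun v => word 0 n (fill v)) c); last exact: fibered_word.
  apply: eq_bigr => w _; congr (_ * _); apply: (congr1 (fun f => fiber_law nu f w)).
  apply/funext => u; apply/esym; apply: word_le (word_fill _); by rewrite leq_addr.
rewrite mulr_sumr -[X in _ - X <= _]mul1r -[X in _ - X * _ <= _](sum_fiber_law nu (@fibered_word N 0 (n + q))) mulr_suml -sumrB.
apply: ler_sum => v _.
have := fiber_law_prefix_le v; have := fiber_law_ge0 nu (@word N 0 (n + q)) v.
set pv := fiber_law nu (@word N 0 (n + q)) v; set pw := fiber_law nu _ _ => pv0 pvw.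
have [pv'|pv'] := ltrP 0 pv; last first.
  by have -> : pv = 0; [apply/eqP; rewrite eq_le pv' pv0|rewrite !mul0r mulr0 subr0].
rewrite mulrCA -mulrBr ler_pM2l//.
have h1 := h _ (fill v) (lt_le_trans pv' pvw) (proj2 (cylinderE _ _) erefl).
have h2 : birkhoff_sum phi n (fill v) <= \sum_(j < n) (phi (fill (word j q (fill v))) + e / 2).
  apply: ler_sum => j _.
  have := qP (iter j sh (fill v)) (fill (word j q (fill v))).
  rewrite word_fill word_iter_shift addn0 => /(_ erefl).
  by have := ler_norm (phi (iter j sh (fill v)) - phi (fill (word j q (fill v)))); lra.
have h3 := le_trans h1 h2.
rewrite lerBlDr -(ler_pM2l nR) mulrDr !mulVKf ?gt_eqF//.
by move: h3; rewrite big_split/= sumr_const card_ord -[X in _ + X]mulr_natl.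
Qed.

End block.

Lemma partition_sum_le (phi : strings N -> R) (e : R) : continuous phi -> 0 < e ->
  (forall mu : borel_prob R N, shift_invariant mu -> C (U mu) ->
     coord_entropy mu + \int[mu]_u phi u <= 0) ->
  \forall n \near \oo, partition_sum U C phi n <= expR (n%:R * e).
Proof.
move=> cphi e0 h; near=> n.
have n0 : (0 < n)%N by near: n; exists 1%N.
have nR : 0 < n%:R :> R by rewrite ltr0n.
have var : forall u v, word 0 n u = word 0 n v ->
    `|birkhoff_sum phi n u - birkhoff_sum phi n v| <= n%:R * e.
  by near: n; exact: birkhoff_variation.
have [Z0|Z0] := leP (partition_sum U C phi n) 0.
  by rewrite (le_trans Z0)// expR_ge0.
pose W : {pred n.-tuple I} := fun w => `[< [set U (empirical R n u) | u in cylinder w] `<=` C >].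
pose s w := sup [set expR (birkhoff_sum phi n u) | u in @cylinder N n w].
have s0 w : 0 < s w.
  have [su _] := sup_cylinder w cphi.
  by apply: lt_le_trans (su (fill w) _); [exact: expR_gt0|apply/cylinderE/word_fill].
have ZE : partition_sum U C phi n = \sum_(w in W) expR (ln (s w)).
  by apply: eq_bigr => w _; rewrite lnK// posrE.
rewrite ZE in Z0 *.
pose p w := if w \in W then expR (ln (s w)) / \sum_(w in W) expR (ln (s w)) else 0.
have [p0 p1 pE] : [/\ forall w, 0 <= p w, \sum_w p w = 1 &
    shannon p + \sum_w p w * ln (s w) = ln (\sum_(w in W) expR (ln (s w)))].
  exact: gibbs_attained.
have [mu [nu [inv muE nup hmu]]] := block_measure n0 p0 p1.
have pW w : 0 < p w -> w \in W by rewrite /p; case: ifP; rewrite ?ltxx.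
have CU : C (U mu).
  apply: (block_U_in n0 muE) => w; rewrite nup => /pW /asboolP wC u wu.
  by apply: wC; exists u.
(* On the cylinder of [w] every Birkhoff sum is at least [ln (s w) - n * e]; this variation is the
   only loss. *)
have intg : n%:R^-1 * \sum_w p w * (ln (s w) - n%:R * e) <= \int[mu]_u phi u.
  rewrite -nup; apply: (block_integral_ge n0 muE cphi) => w u _ wu.
  rewrite lerBlDr -ler_expR lnK ?posrE//.
  have [_] := sup_cylinder w cphi; apply => v wv; rewrite ler_expR.
  rewrite -lerBlDl (le_trans (ler_norm _))//; apply: var.
  by move/cylinderE : wu => ->; apply/cylinderE.
have := h mu inv CU.
rewrite -ler_ln ?posrE ?expR_gt0// expRK -pE => fin.
have : n%:R^-1 * (shannon p + \sum_w p w * (ln (s w) - n%:R * e)) <= 0.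
  by rewrite mulrDr; apply: le_trans fin; rewrite lerD.
rewrite pmulr_rle0 ?invr_gt0//.
under eq_bigr do rewrite mulrBr.
by rewrite sumrB -mulr_suml p1 mul1r addrA subr_le0.
Unshelve. all: by end_near. Qed.

End upper_bound.

(** * Lower bound for the partition sums *)

Section counting.
Context {R : realType}.

Lemma sum_lt_le m q : \sum_(j < m) (j < q)%N%:R <= q%:R :> R.
Proof.
rewrite -natr_sum ler_nat.
suff -> : (\sum_(j < m) (j < q) = minn m q)%N by exact: geq_minr.
elim: m => [|m IH]; first by rewrite big_ord0 min0n.
by rewrite big_ord_recr/= IH; lia.
Qed.

(** Counts the windows of length [q] that start before [m] and run past it. *)
Lemma sum_overlap_le m q : \sum_(j < m) (m < j + q)%N%:R <= q%:R :> R.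
Proof.
rewrite (reindex_inj rev_ord_inj)/=; apply: le_trans (sum_lt_le m q).
by apply: ler_sum => j _; rewrite ler_nat; have := ltn_ord j; lia.
Qed.

Lemma sum_blocks (F : nat -> R) k m :
  \sum_(l < k * m) F l = \sum_(i < k) \sum_(j < m) F (i * m + j)%N.
Proof.
elim: k F => [|k IH] F; first by rewrite !big_ord0.
rewrite big_ord_recl -[(k.+1 * m)%N]/(m + k * m)%N big_split_ord/=; congr (_ + _).
rewrite (IH (fun l => F (m + l)%N)); apply: eq_bigr => i _; apply: eq_bigr => j _.
by rewrite /bump add1n mulSn addnA.
Qed.

End counting.

Section words.
Context {R : realType} {N : nat}.
Notation I := 'I_N.+1.
Notation sh := (@shift_map N).

(** Occurrences are counted by their starting position and may end beyond [m]; this produces the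
    boundary errors [q] below. *)
Definition occ (q : nat) (c : q.-tuple I) (m : nat) (u : strings N) : R :=
  \sum_(j < m) (word j q u == c)%:R.

Lemma occ_bound q (c : q.-tuple I) m (u v : strings N) :
  word 0 m u = word 0 m v -> `|occ c m u - occ c m v| <= q%:R.
Proof.
move=> uv; rewrite -sumrB (le_trans (ler_norm_sum _ _ _))//.
apply: le_trans (sum_overlap_le m q); apply: ler_sum => j _.
case: leqP => jm; last first.
  by case: (_ == _); case: (_ == _); rewrite ?subrr ?subr0 ?sub0r ?normrN ?normr0 ?normr1.
rewrite (_ : word j q u = word j q v) ?subrr ?normr0//.
apply/eq_wordP => k kq; move/eq_wordP : uv => /(_ (j + k)%N); rewrite !add0n; apply.
lia.
Qed.

(** With [m + q] letters every window is seen and invariance gives the mean exactly; cutting back to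
    [m] letters costs at most [q]. *)
Lemma occ_mean (mu : borel_prob R N) q (c : q.-tuple I) m : shift_invariant mu ->
  `|\sum_(w : m.-tuple I) fiber_law mu (@word N 0 m) w * occ c m (fill w)
     - m%:R * fiber_law mu (@word N 0 q) c| <= q%:R.
Proof.
move=> inv.
pose M := (m + q)%N.
pose r (v : M.-tuple I) := word 0 m (fill v).
have -> : \sum_(w : m.-tuple I) fiber_law mu (@word N 0 m) w * occ c m (fill w) =
   \sum_v fiber_law mu (@word N 0 M) v * occ c m (fill (r v)).
  rewrite -(@sum_fiber_law_comp _ _ _ mu _ _ (@word N 0 M) r (fun w => occ c m (fill w))); last exact: fibered_word.
  apply: eq_bigr => w _; congr (_ * _); apply: (congr1 (fun f => fiber_law mu f w)).
  apply/funext => u; rewrite /r; apply/esym; apply: word_le (word_fill _).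
  exact: leq_addr.
have -> : m%:R * fiber_law mu (@word N 0 q) c = \sum_v fiber_law mu (@word N 0 M) v * occ c m (fill v).
  under eq_bigr do rewrite mulr_sumr.
  rewrite exchange_big/= mulr_natl -[m in LHS]card_ord -sumr_const; apply: eq_bigr => j _.
  rewrite -(@sum_fiber_law_comp _ _ _ mu _ _ (@word N 0 M) (fun v => word j q (fill v)) (fun d => (d == c)%:R)); last exact: fibered_word.
  rewrite (bigD1 c)//= eqxx mulr1 big1 ?addr0; last first.
    by move=> d /negbTE ->; rewrite mulr0.
  rewrite -(fiber_law_shift inv j (@fibered_word N 0 q)).
  apply: (congr1 (fun f => fiber_law mu f c)); apply/funext => u.
  rewrite word_iter_shift addn0; apply/eq_wordP => k kq.
  have lt : (j + k < M)%N by have := ltn_ord j; rewrite /M; lia.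
  by rewrite /fill (nth_mktuple _ _ (Ordinal lt)).
rewrite -sumrB (le_trans (ler_norm_sum _ _ _))//.
rewrite -[leRHS]mul1r -[X in _ <= X * _](sum_fiber_law mu (@fibered_word N 0 M)) mulr_suml.
apply: ler_sum => v _; rewrite -mulrBr normrM ger0_norm ?fiber_law_ge0// ler_wpM2l ?fiber_law_ge0//.
by apply: occ_bound; rewrite word_fill.
Qed.

Lemma occ_blocks q (c : q.-tuple I) k m (x : {ffun 'I_k -> m.-tuple I}) u :
  (forall i : 'I_k, word (i * m) m u = x i) ->
  `|occ c (k * m) u - \sum_i occ c m (fill (x i))| <= k%:R * q%:R.
Proof.
move=> ux; rewrite /occ (sum_blocks (fun l => (word l q u == c)%:R)) -sumrB.
rewrite (le_trans (ler_norm_sum _ _ _))// mulr_natl -[X in _ *+ X]card_ord -sumr_const.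
apply: ler_sum => i _.
have -> : \sum_(j < m) (word (i * m + j) q u == c)%:R = occ c m (iter (i * m) sh u).
  by apply: eq_bigr => j _; rewrite word_iter_shift.
by apply: occ_bound; rewrite word_iter_shift addn0 ux word_fill.
Qed.

Lemma occ_split q (c : q.-tuple I) a b u :
  occ c a u <= occ c (a + b) u <= occ c a u + b%:R.
Proof.
rewrite /occ big_split_ord/= lerDl sumr_ge0//= lerD2l.
rewrite -[b in leRHS]card_ord -sumr_const; apply: ler_sum => j _.
by rewrite lern1 leq_b1.
Qed.

Lemma fiber_law_empirical_occ n u q (c : q.-tuple I) : (0 < n)%N ->
  fiber_law (empirical R n u) (@word N 0 q) c = n%:R^-1 * occ c n u.
Proof.
move=> n0; rewrite fiber_law_empirical//; congr (_ * _).
by apply: eq_bigr => j _; rewrite word_iter_shift addn0.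
Qed.

(** When [k * m <= n], the letters after the last block are set to [ord0]. *)
Definition concat n k m (x : {ffun 'I_k -> m.-tuple I}) : n.-tuple I :=
  [tuple if insub (l %/ m)%N is Some i then nth ord0 (x i) (l %% m) else ord0 | l < n].

Lemma word_concat n k m (x : {ffun 'I_k -> m.-tuple I}) u : (k * m <= n)%N ->
  word 0 n u = concat n x -> forall i : 'I_k, word (i * m) m u = x i.
Proof.
move=> kmn ux i; apply: eq_from_tnth => j; rewrite tnth_word.
have m0 : (0 < m)%N by apply: leq_ltn_trans (ltn_ord j).
have lt : (i * m + j < n)%N.
  apply: leq_trans kmn; apply: (@leq_trans (i.+1 * m)); first by rewrite mulSn addnC ltn_add2r.
  by rewrite leq_mul2r ltn_ord orbT.
have := congr1 (fun t => tnth t (Ordinal lt)) ux; rewrite tnth_word tnth_mktuple /= add0n => ->.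
rewrite divnMDl// divn_small// addn0 modnMDl modn_small//.
by rewrite valK (tnth_nth ord0).
Qed.

Lemma concat_inj n k m : (k * m <= n)%N -> injective (@concat n k m).
Proof.
move=> kmn x y xy; apply/ffunP => i.
have h := word_concat kmn (word_fill (concat n x)).
rewrite -(h i); have h' := word_concat kmn (u := fill (concat n x)) (x := y).
by apply: h'; rewrite word_fill xy.
Qed.

(** The typical sequences of [k = n %/ m] independent blocks carry at least half the mass, while
    each has probability at most [exp (- k (H - dl))], where [H] is the entropy of a block. This
    bounds their number from below, and [concat] keeps them distinct. Their counts of words of
    length [q] put all the empirical measures in [A]. *)
Lemma many_typical_words (mu : borel_prob R N) (A : set (borel_prob R N)) (e : R) :
  shift_invariant mu -> words_filter mu A -> 0 < e ->
  \forall n \near \oo,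
    expR (n%:R * (coord_entropy mu - e)) <=
    #|[pred w : n.-tuple I | `[< forall u, cylinder w u -> A (empirical R n u) >]]|%:R.
Proof.
move=> inv [[q d] /= d0 qdA] e0.
(* Blocks long enough that [2 * q] miscounted windows per block are a small proportion, and that the
   block entropy per letter is nearly the limit. *)
have [m [m0 qm Hm]] : exists m, [/\ (0 < m)%N, 2 * q%:R <= m%:R * (d / 3) &
    coord_entropy mu - e / 4 <= m%:R^-1 * shannon (fiber_law mu (@word N 0 m))].
  have hc := coord_entropy_cvg inv.
  have : \forall m \near \oo, [/\ (0 < m)%N, 2 * q%:R <= m%:R * (d / 3) &
      coord_entropy mu - e / 4 <= m%:R^-1 * shannon (fiber_law mu (@word N 0 m))].
    near=> m; split.
    - by near: m; exists 1%N.
    - by rewrite -ler_pdivrMr ?divr_gt0//; near: m; exact: nbhs_infty_ger.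
    - have : `|coord_entropy mu - m%:R^-1 * shannon (fiber_law mu (@word N 0 m))| <= e / 4.
        by near: m; move/cvgrPdist_le : hc; apply; rewrite divr_gt0.
      by rewrite ler_norml => /andP[_]; rewrite lerBlDr addrC -lerBlDr.
  by move=> [k _ /(_ k (leqnn k))]; exists k.
have mR : 0 < m%:R :> R by rewrite ltr0n.
pose p := fiber_law mu (@word N 0 m).
have p0 : forall w, 0 <= p w by exact: fiber_law_ge0.
have p1 : \sum_w p w = 1 by apply: sum_fiber_law; exact: fibered_word.
(* [Some c] counts the occurrences of [c] in a block; [None] is the information content of the
   block, whose mean is the block entropy. *)
pose y (o : option (q.-tuple I)) (w : m.-tuple I) : R :=
  if o is Some c then occ c m (fill w) else - ln (p w).
pose dl := Num.min (d / 3) (e / 4).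
have dl0 : 0 < dl by rewrite lt_min !divr_gt0.
have dld : dl <= d / 3 by rewrite ge_min lexx.
have dle : dl <= e / 4 by rewrite ge_min lexx orbT.
have [k0 _ k0P] := prodp_typical y p0 p1 dl0.
pose x0 := coord_entropy mu - e / 4.
near=> n.
have n0 : (0 < n)%N by near: n; exists 1%N.
have nR : 0 < n%:R :> R by rewrite ltr0n.
pose k := (n %/ m)%N.
have kmn : (k * m <= n)%N by exact: leq_trunc_div.
have nkm : (n < k * m + m)%N by rewrite {1}(divn_eq n m) ltn_add2l ltn_mod.
have kk0 : (k0 <= k)%N.
  by rewrite /k leq_divRL//; near: n; exists (k0 * m)%N.
have := k0P _ kk0; set G := BIG_P => Ghalf.
have n1 : 2 * m%:R <= n%:R * (d / 3).
  by rewrite -ler_pdivrMr ?divr_gt0//; near: n; exact: nbhs_infty_ger.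
have n2 : m%:R * `|x0| + ln 2 <= n%:R * (e / 2).
  by rewrite -ler_pdivrMr ?divr_gt0//; near: n; exact: nbhs_infty_ger.
have kmR : k%:R * m%:R <= n%:R :> R by rewrite -natrM ler_nat.
have nkmR : n%:R <= k%:R * m%:R + m%:R :> R by rewrite -natrM -natrD ler_nat ltnW.
have k0R : 0 <= k%:R :> R by [].
have kn : k%:R <= n%:R :> R by rewrite ler_nat leq_div.
(* The distance [d] is spent in thirds: on windows that cross block ends, on the deviation allowed
   to a typical sequence, and on the incomplete last block. *)
have good (x : {ffun 'I_k -> m.-tuple I}) : G x ->
    forall u, cylinder (concat n x) u -> A (empirical R n u).
  move=> /forallP Gx u /cylinderE ux; apply: qdA => c.
  rewrite fiber_law_empirical_occ//.
  have xb := word_concat kmn ux.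
  have h1 := occ_blocks c xb.
  have h2 := Gx (Some c); rewrite /= -/p in h2.
  have h3 := occ_mean c m inv; rewrite -/p in h3.
  have /andP[h4 h5] := occ_split c (k * m) (n - k * m) u.
  rewrite subnKC// in h4 h5.
  have h6 : (n - k * m)%:R <= m%:R :> R by rewrite ler_nat leq_subLR ltnW.
  have pi0 := fiber_law_ge0 mu (@word N 0 q) c.
  have pi1 : fiber_law mu (@word N 0 q) c <= 1.
    by apply: (pmf_le1 _ (fiber_law_ge0 mu _)); apply: sum_fiber_law; exact: fibered_word.
  move: h1 h2 h3 h4 h5; move: (occ c (k * m) u) (occ c n u) (\sum_i occ c m (fill (x i)))
    (\sum_t p t * occ c m (fill t)) (fiber_law mu (@word N 0 q) c) pi0 pi1 => o1 o2 S E pi pi0 pi1.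
  move=> h1 h2 h3 h4 h5.
  rewrite -(ler_pM2l nR) -[X in X * `|_|]gtr0_norm// -normrM mulrBr mulVKf ?gt_eqF//.
  have h7 : `|k%:R * E - k%:R * (m%:R * pi)| <= k%:R * q%:R.
    by rewrite -mulrBr normrM ger0_norm// ler_wpM2l.
  have h8 : k%:R * q%:R * 2 <= n%:R * (d / 3).
    apply: (@le_trans _ _ (k%:R * (m%:R * (d / 3)))); last first.
      by rewrite mulrA ler_wpM2r// divr_ge0 ?ltW.
    by rewrite -mulrA ler_wpM2l// mulrC.
  have h9 : k%:R * dl <= n%:R * (d / 3) by rewrite ler_pM// ltW.
  have h10 : `|k%:R * (m%:R * pi) - n%:R * pi| <= m%:R.
    rewrite mulrA -mulrBl normrM (ger0_norm pi0) distrC ger0_norm ?subr_ge0//.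
    rewrite -[leRHS]mulr1 ler_pM ?subr_ge0//.
    by rewrite lerBlDr addrC.
  move: h1 h2 h7 h10; rewrite !ler_norml => /andP[? ?] /andP[? ?] /andP[? ?] /andP[? ?].
  by apply/andP; split; lra.
have small (x : {ffun 'I_k -> m.-tuple I}) : G x -> prodp p x <= expR (- (k%:R * (shannon p - dl))).
  move=> /forallP /(_ None) /= Gx.
  have [px|px] := ltrP 0 (prodp p x); last by rewrite (le_trans px)// expR_ge0.
  rewrite -ler_ln ?posrE ?expR_gt0// expRK ln_prodp//.
  have EE : \sum_t p t * - ln (p t) = shannon p.
    by rewrite /shannon -sumrN; apply: eq_bigr => t _; rewrite mulrN.
  move: Gx; rewrite EE sumrN ler_norml => /andP[Gx _].
  by rewrite mulrBr; lra.
have card : 2^-1 * expR (k%:R * (shannon p - dl)) <= #|G|%:R.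
  rewrite -ler_pdivlMr ?expR_gt0// -expRN.
  apply: (le_trans Ghalf); rewrite -sum1_card natr_sum mulr_suml.
  by apply: ler_sum => x Gx; rewrite mul1r small.
apply: (@le_trans _ _ #|G|%:R).
  apply: le_trans card.
  have -> : 2^-1 = expR (- ln 2) :> R by rewrite expRN lnK ?posrE.
  (* The loss [e] is [e / 4] from the choice of [m], [e / 4] from [dl], and [e / 2] for the factor
     one half and the incomplete block. *)
  rewrite -expRD ler_expR.
  have H1 : m%:R * x0 <= shannon p by rewrite -ler_pdivlMl.
  have H2 : k%:R * (m%:R * x0) <= k%:R * shannon p by rewrite ler_wpM2l.
  have H3 : n%:R * x0 - m%:R * `|x0| <= k%:R * (m%:R * x0).
    have : (n%:R - k%:R * m%:R) * x0 <= m%:R * `|x0|.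
      apply: (le_trans (ler_norm _)); rewrite normrM ger0_norm ?subr_ge0//.
      by rewrite ler_wpM2r// lerBlDr addrC.
    by rewrite mulrBl mulrA; lra.
  have H4 : k%:R * dl <= n%:R * (e / 4) by rewrite ler_pM// ltW.
  have H5 : n%:R * x0 = n%:R * coord_entropy mu - n%:R * (e / 4) by rewrite mulrBr.
  rewrite mulrBr [X in _ <= _ + X]mulrBr.
  have H6 : n%:R * (e / 2) + n%:R * (e / 4) + n%:R * (e / 4) = n%:R * e by field.
  lra.
rewrite ler_nat -(fintype.card_image (@concat_inj n k m kmn)).
apply: subset_leq_card; apply/fintype.subsetP => w /fintype.imageP[x Gx ->].
have wA := good x Gx; rewrite inE; exact: wA.
Unshelve. all: by end_near. Qed.

End words.

Section integrals.
Context {R : realType} {N : nat}.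
Notation sh := (@shift_map N).

Lemma Rintegral_empirical n u (phi : strings N -> R) : (0 < n)%N -> continuous phi ->
  \int[empirical R n u]_v phi v = n%:R^-1 * birkhoff_sum phi n u.
Proof.
move=> n0 cphi; apply/eqP; rewrite -subr_eq0 -normr_le0.
apply/ler_addgt0Pl => e e0; rewrite addr0.
have [q _ /(_ q (leqnn q)) qP] := continuous_word cphi (divr_gt0 e0 (ltr0n _ 2)).
have h1 := Rintegral_approx (empirical R n u) cphi qP.
have nR : 0 < n%:R :> R by rewrite ltr0n.
set S := \sum_w _ in h1.
have SE : S = n%:R^-1 * \sum_(k < n) phi (fill (word 0 q (iter k sh u))).
  rewrite /S; under eq_bigr do rewrite fiber_law_empirical// -mulrA mulr_suml.
  rewrite -mulr_sumr exchange_big/=; congr (_ * _); apply: eq_bigr => k _.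
  rewrite (bigD1 (word 0 q (iter k sh u)))//= eqxx mul1r big1 ?addr0// => w.
  by rewrite eq_sym => /negbTE ->; rewrite mul0r.
have h2 : `|S - n%:R^-1 * birkhoff_sum phi n u| <= e / 2.
  rewrite SE -mulrBr normrM gtr0_norm ?invr_gt0// ler_pdivrMl//.
  rewrite -sumrB (le_trans (ler_norm_sum _ _ _))//.
  rewrite (@le_trans _ _ (\sum_(k < n) (e / 2)))//.
    by apply: ler_sum => k _; apply: qP; rewrite word_fill.
  by rewrite sumr_const card_ord mulr_natl.
rewrite [e]splitr -(subrKA S) (le_trans (ler_normD _ _))// lerD//.
Qed.

Lemma Rintegral_mixture (J : finType) (a : J -> R) (m : J -> borel_prob R N)
    (rho : borel_prob R N) (phi : strings N -> R) :
  (forall j, 0 <= a j) -> \sum_j a j = 1 ->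
  (forall A, measurable A -> rho A = (\sum_j a j * fine (m j A))%:E) ->
  continuous phi ->
  \int[rho]_u phi u = \sum_j a j * \int[m j]_u phi u.
Proof.
move=> a0 a1 rhoE cphi; apply/eqP; rewrite -subr_eq0 -normr_le0.
apply/ler_addgt0Pl => e e0; rewrite addr0.
have [q _ /(_ q (leqnn q)) qP] := continuous_word cphi (divr_gt0 e0 (ltr0n _ 2)).
have h1 := Rintegral_approx rho cphi qP.
set S := \sum_w _ in h1.
have SE : S = \sum_j a j * \sum_w fiber_law (m j) (@word N 0 q) w * phi (fill w).
  transitivity (\sum_w \sum_j a j * fiber_law (m j) (@word N 0 q) w * phi (fill w)).
    apply: eq_bigr => w _; rewrite -mulr_suml; congr (_ * _).
    by rewrite {1}/fiber_law rhoE//; exact: fibered_word.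
  rewrite exchange_big/=; apply: eq_bigr => j _; rewrite mulr_sumr.
  by apply: eq_bigr => w _; rewrite mulrA.
have h2 : `|S - \sum_j a j * \int[m j]_u phi u| <= e / 2.
  rewrite SE -sumrB (le_trans (ler_norm_sum _ _ _))//.
  rewrite -[leRHS]mul1r -[X in _ <= X * _]a1 mulr_suml; apply: ler_sum => j _.
  rewrite -mulrBr normrM ger0_norm// ler_wpM2l// distrC.
  exact: Rintegral_approx.
rewrite [e]splitr -(subrKA S) (le_trans (ler_normD _ _))// lerD//.
Qed.

Lemma shift_invariant_mixture (J : finType) (a : J -> R) (m : J -> borel_prob R N)
    (rho : borel_prob R N) :
  (forall A, measurable A -> rho A = (\sum_j a j * fine (m j A))%:E) ->
  (forall j, shift_invariant (m j)) -> shift_invariant rho.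
Proof.
move=> rhoE inv A mA.
have mS : measurable (sh @^-1` A).
  by rewrite -[X in measurable X]setTI; exact: (@shift_measurable N 1).
by rewrite !rhoE//; congr EFin; apply: eq_bigr => j _; rewrite inv.
Qed.

Lemma coord_entropy_mixture (J : finType) (a : J -> R) (m : J -> borel_prob R N)
    (rho : borel_prob R N) :
  (forall j, 0 <= a j) -> \sum_j a j = 1 ->
  (forall A, measurable A -> rho A = (\sum_j a j * fine (m j A))%:E) ->
  (forall j, shift_invariant (m j)) ->
  \sum_j a j * coord_entropy (m j) <= coord_entropy rho.
Proof.
move=> a0 a1 rhoE inv.
have ir := shift_invariant_mixture rhoE inv.
have cv : (fun n => \sum_j a j * (n%:R^-1 * shannon (fiber_law (m j) (@word N 0 n)))) @ \oo -->
    \sum_j a j * coord_entropy (m j).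
  apply: cvg_big => [|j _]; first exact: add_continuous.
  by apply: cvgM; [exact: cvg_cst|exact: coord_entropy_cvg].
apply: (ler_cvg_to cv (coord_entropy_cvg ir)); apply: nearW => n.
under eq_bigr do rewrite mulrCA.
by rewrite -mulr_sumr ler_wpM2l// shannon_word_mixture.
Qed.

End integrals.

Section lower_bound.
Context {R : realType} {N : nat} {X : normedModType R}.
Notation I := 'I_N.+1.
Notation sh := (@shift_map N).
Variables (Gamma : borel_prob R N -> X) (Delta : borel_prob R N -> R).
Hypotheses (cG : continuous Gamma) (affG : affine_prob Gamma)
  (cD : continuous Delta)
  (affD : affine_prob (Delta : borel_prob R N -> R^o))
  (D0 : forall mu, Delta mu != 0).
Let U := fun mu : borel_prob R N => (Delta mu)^-1 *: Gamma mu.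
Variable C : set X.
Hypothesis convC : convex_set (C : set (convex_lmodType X)).
Variables (phi : strings N -> R).
Hypothesis cphi : continuous phi.

(** At least [exp (n (h - e / 2))] words have all their empirical measures in [A]. Such a word is
    counted because [U] sends [A] into [C], and its term is at least [exp (n (I - e / 2))], with [I]
    the integral of [phi], as one sees at [fill w]. *)
Lemma partition_sum_ge_interior (mu : borel_prob R N) (e : R) :
  shift_invariant mu -> C° (U mu) -> 0 < e ->
  \forall n \near \oo,
    expR (n%:R * (coord_entropy mu + \int[mu]_u phi u - e)) <= partition_sum U C phi n.
Proof.
move=> inv CU e0.
pose A := [set nu : borel_prob R N | C (U nu) /\ \int[mu]_u phi u - e / 2 <= \int[nu]_u phi u].
have e2 : 0 < e / 2 by rewrite divr_gt0.
have FA : words_filter mu A.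
  have F1 : words_filter mu [set nu | C (U nu)].
    have /nbhs_borel_prob[n [d d0 nd]] : nbhs mu (U @^-1` C).
      exact: (@U_continuous _ _ _ _ _ cG cD D0 mu C CU).
    by exists (n, d).
  have FF := words_filter_filter mu.
  have F2 : words_filter mu [set nu | \int[mu]_u phi u - e / 2 <= \int[nu]_u phi u].
    have /cvgrPdist_le/(_ _ e2) := words_filter_integral (mu := mu) cphi.
    apply: filterS => nu /= nuh; have := le_trans (ler_norm _) nuh.
    by rewrite /= !lerBlDr addrC.
  exact: filterI F1 F2.
have := many_typical_words inv FA e2; apply: filter_app; near=> n => cardn.
have n0 : (0 < n)%N by near: n; exists 1%N.
have nR : 0 < n%:R :> R by rewrite ltr0n.
set G := [pred w | _] in cardn.
have -> : n%:R * (coord_entropy mu + \int[mu]_u phi u - e) =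
    n%:R * (coord_entropy mu - e / 2) + n%:R * (\int[mu]_u phi u - e / 2) by field.
rewrite expRD.
apply: (@le_trans _ _ (#|G|%:R * expR (n%:R * (\int[mu]_u phi u - e / 2)))).
  by rewrite ler_wpM2r// expR_ge0.
rewrite -sum1_card natr_sum mulr_suml /partition_sum [leLHS]big_mkcond [leRHS]big_mkcond/=.
apply: ler_sum => w _.
have [su _] := sup_cylinder w cphi.
have wf : cylinder w (fill w) by apply/cylinderE/word_fill.
have s_ge0 := le_trans (expR_ge0 _) (su _ wf).
rewrite mul1r; case: ifP => [/asboolP wA|_]; last by case: ifP.
rewrite ifT; last by apply/asboolP => _ [u wu <-]; have [] := wA u wu.
apply: le_trans (su _ wf); rewrite ler_expR.
have [_] := wA _ wf; rewrite Rintegral_empirical//.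
by rewrite -(ler_pM2l nR) mulVKf ?gt_eqF.
Unshelve. all: by end_near. Qed.

Lemma partition_sum_ge (nu mu : borel_prob R N) (e : R) :
  shift_invariant nu -> C° (U nu) -> shift_invariant mu -> C (U mu) -> 0 < e ->
  \forall n \near \oo,
    expR (n%:R * (coord_entropy mu + \int[mu]_u phi u - e)) <= partition_sum U C phi n.
Proof.
move=> inu Cnu imu Cmu e0.
pose D := coord_entropy mu + \int[mu]_u phi u - (coord_entropy nu + \int[nu]_u phi u).
(* Giving weight [t] to [nu] costs at most [t * D], by concavity of the entropy; the summand [e]
   keeps the denominator positive and [t] below 1. *)
pose t := (e / 2) / (`|D| + e).
have De : 0 < `|D| + e by rewrite ltr_wpDl.
have t0 : 0 < t by rewrite !divr_gt0.
have tD : t * D <= e / 2.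
  rewrite /t mulrAC ler_pdivrMr// ler_wpM2l ?divr_ge0// ?(ltW e0)//.
  by rewrite (le_trans (ler_norm _))// lerDl ltW.
have t1 : t <= 1.
  by rewrite /t ler_pdivrMr// mul1r; have := normr_ge0 D; lra.
have a0 (b : bool) : 0 <= if b then t else 1 - t by case: b; rewrite ?subr_ge0// ltW.
have a1 : \sum_(b : bool) (if b then t else 1 - t) = 1 by rewrite big_bool/= addrC subrK.
have [rho rhoE] := mixture (fun b : bool => if b then nu else mu) a0 a1.
have inv (b : bool) : shift_invariant (if b then nu else mu) by case: b.
have irho := shift_invariant_mixture rhoE inv.
have hrho := coord_entropy_mixture a0 a1 rhoE inv.
have prho := Rintegral_mixture a0 a1 rhoE cphi.
rewrite !big_bool/= in hrho prho.
have Crho : C° (U rho).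
  have t01 : 0 <= t <= 1 by rewrite t1 ltW.
  have [A mA|s [/andP[s0 s1] st] E] := U_mix affG affD D0 (mu := nu) (nu := mu) (rho := rho) t01.
    by rewrite rhoE// big_bool/= EFinD !EFinM !fineK// fin_num_measure.
  by rewrite /U E; apply: convex_interior => //; rewrite st.
have := partition_sum_ge_interior irho Crho (divr_gt0 e0 (ltr0n _ 2)).
apply: filterS => n; apply: le_trans; rewrite ler_expR ler_wpM2l//.
by rewrite prho; move: hrho tD; rewrite /D; lra.
Qed.

End lower_bound.

(** * Growth rates, pressure and radius of convergence *)

Lemma bernoulli_le {R : realType} (q : R) n : 1 <= q -> 1 + n%:R * (q - 1) <= q ^+ n.
Proof.
move=> q1; have q0 : 0 <= q - 1 by rewrite subr_ge0.
elim: n => [|n IH]; first by rewrite mul0r addr0 expr0.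
have q0' : 0 <= q by exact: le_trans ler01 q1.
rewrite exprS; apply: le_trans (ler_wpM2l q0' IH).
rewrite -natr1 -subr_ge0 (_ : _ - _ = n%:R * (q - 1) ^+ 2); last by ring.
by rewrite mulr_ge0 ?sqr_ge0.
Qed.

Section growth.
Context {R : realType}.
Variable Z : R^nat.

Lemma limn_esup_le_growth (b : R) : (\forall n \near \oo, Z n <= expR (n%:R * b)) ->
  (limn_esup (fun n => (n%:R^-1)%:E * lne (Z n)%:E) <= b%:E)%E.
Proof.
move=> [n0 _ Zb]; rewrite limn_esup_lim; apply: lime_le; first exact: is_cvg_esups.
exists n0.+1 => // m /= n0m; apply: ge_ereal_sup => _ [k /= mk <-].
have k0 : (0 < k)%N by apply: leq_trans mk; apply: leq_trans n0m.
have kR : 0 < k%:R :> R by rewrite ltr0n.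
have := Zb k (leq_trans (ltnW n0m) mk); rewrite /=.
case: ifPn => [_ _|]; first by rewrite gt0_muleNy ?leNye// lte_fin invr_gt0.
rewrite -ltNge => Zk; rewrite -ler_ln ?posrE ?expR_gt0// expRK => h.
by rewrite -EFinM lee_fin ler_pdivrMl.
Qed.

Lemma limn_einf_ge_growth (b : R) : (\forall n \near \oo, expR (n%:R * b) <= Z n) ->
  (b%:E <= limn_einf (fun n => (n%:R^-1)%:E * lne (Z n)%:E))%E.
Proof.
move=> [n0 _ Zb]; rewrite limn_einf_lim; apply: lime_ge; first exact: is_cvg_einfs.
exists n0.+1 => // m /= n0m; apply: le_ereal_inf_tmp => _ [k /= mk <-].
have k0 : (0 < k)%N by apply: leq_trans mk; apply: leq_trans n0m.
have kR : 0 < k%:R :> R by rewrite ltr0n.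
have := Zb k (leq_trans (ltnW n0m) mk) => h.
have Zk : 0 < Z k by apply: lt_le_trans h; exact: expR_gt0.
have -> : (Z k <= 0) = false by rewrite leNgt Zk.
rewrite -EFinM lee_fin ler_pdivlMl//.
by rewrite -ler_expR lnK ?posrE.
Qed.

Hypothesis Z0 : forall n, 0 <= Z n.
Let coef : R^nat := fun n => n%:R^-1 * Z n.

Lemma cvg_pseries_growth (b z : R) : (\forall n \near \oo, Z n <= expR (n%:R * b)) ->
  0 <= z -> z < expR (- b) -> cvgn (pseries coef z).
Proof.
move=> [n0 _ Zb] z0 zb.
have q1 : `|expR b * z| < 1.
  rewrite ger0_norm ?mulr_ge0 ?expR_ge0// mulrC -ltr_pdivlMr ?expR_gt0//.
  by rewrite mul1r -expRN.
(* Absorbs the finitely many terms below [n0], so that the geometric comparison holds for every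
   [n]. *)
pose K := 1 + \sum_(i < n0) Z i * expR (- (i%:R * b)).
have K1 : 1 <= K by rewrite lerDl sumr_ge0// => i _; rewrite mulr_ge0 ?expR_ge0.
have ZK n : Z n <= K * expR (n%:R * b).
  have [nn0|n0n] := ltnP n n0.
    rewrite -ler_pdivrMr ?expR_gt0// -expRN /K (bigD1 (Ordinal nn0))//= addrCA lerDl.
    by rewrite addr_ge0// sumr_ge0// => i _; rewrite mulr_ge0 ?expR_ge0.
  by apply: (le_trans (Zb n n0n)); rewrite ler_peMl ?expR_ge0.
apply: (series_le_cvg _ _ _ (is_cvg_geometric_series (a := K) q1)) => n /=.
- by rewrite /coef !mulr_ge0 ?exprn_ge0.
- by apply: mulr_ge0; [exact: le_trans ler01 K1|rewrite exprn_ge0// mulr_ge0 ?expR_ge0].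
- rewrite /coef exprMn mulrA ler_wpM2r ?exprn_ge0//.
  rewrite -expRM_natl; apply: le_trans (ZK n).
  case: n => [|n]; first by rewrite invr0 mul0r Z0.
  by rewrite -[leRHS]mul1r ler_wpM2r// invf_le1 ?ltr0n// ler1n.
Qed.

(** Otherwise the terms are eventually at least [q ^ n / n] in absolute value with [1 < q], hence at
    least [q - 1] by Bernoulli's inequality, and do not tend to 0. *)
Lemma pseries_cvg_le_growth (b z : R) : (\forall n \near \oo, expR (n%:R * b) <= Z n) ->
  cvgn (pseries coef z) -> `|z| <= expR (- b).
Proof.
move=> Zb /cvg_series_cvg_0 cz; rewrite leNgt; apply/negP => zb.
pose q := expR b * `|z|.
have q1 : 1 < q.
  by rewrite /q mulrC -ltr_pdivrMr ?expR_gt0// mul1r -expRN.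
have q10 : 0 < q - 1 by rewrite subr_gt0.
have q2 : 0 < (q - 1) / 2 by rewrite divr_gt0.
move/cvgrPdist_le : cz => /(_ _ q2) cz.
have [n [n0 Zn zn]] : exists n, [/\ (0 < n)%N, expR (n%:R * b) <= Z n &
    `|0 - coef n * z ^+ n| <= (q - 1) / 2].
  have : \forall n \near \oo, [/\ (0 < n)%N, expR (n%:R * b) <= Z n &
      `|0 - coef n * z ^+ n| <= (q - 1) / 2].
    near=> n; split; [by near: n; exists 1%N|by near: n|by near: n].
  by move=> [n _ /(_ n (leqnn n))]; exists n.
have nR : 0 < n%:R :> R by rewrite ltr0n.
have : q - 1 <= (q - 1) / 2; last by lra.
apply: le_trans zn; rewrite sub0r normrN normrM normrX /coef normrM.
rewrite (ger0_norm (Z0 n)) ger0_norm ?invr_ge0//.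
rewrite -mulrA ler_pdivlMl//.
apply: (@le_trans _ _ (q ^+ n)).
  have : 1 + n%:R * (q - 1) <= q ^+ n.
    exact/bernoulli_le/ltW.
  lra.
by rewrite /q exprMn -expRM_natl ler_wpM2r ?exprn_ge0.
Unshelve. all: by end_near. Qed.

End growth.

(** * Dependence of the growth rate on the scaling parameter *)

Section scaling.
Context {R : realType} {N : nat} {X : normedModType R}.
Variables (U : borel_prob R N -> X) (C : set X) (Phi : strings N -> R) (c : R).
Hypotheses (cPhi : continuous Phi) (Phic : forall u, Phi u <= - c).

Lemma scale_continuous (s : R) : continuous (fun u => s * Phi u).
Proof. by move=> u; apply: (@cvgM _ _ (nbhs u) _ (fun=> s) Phi); [exact: cvg_cst|exact: cPhi]. Qed.

Lemma birkhoff_sum_scale (s : R) n u :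
  birkhoff_sum (fun u => s * Phi u) n u = s * birkhoff_sum Phi n u.
Proof. by rewrite /birkhoff_sum mulr_sumr. Qed.

Lemma partition_sum_ge0 (phi : strings N -> R) n : continuous phi ->
  0 <= partition_sum U C phi n.
Proof.
move=> cphi; apply: sumr_ge0 => w _.
have [su _] := sup_cylinder w cphi.
by apply: le_trans (su (fill w) _); [exact: expR_ge0|apply/cylinderE/word_fill].
Qed.

(** Every Birkhoff sum of [Phi] is at most [- n * c], so raising the parameter from [s] to [t]
    multiplies each exponential by at most [exp (- n (t - s) c)]. *)
Lemma partition_sum_scale (s t : R) n : s <= t ->
  partition_sum U C (fun u => t * Phi u) n <=
  expR (n%:R * - ((t - s) * c)) * partition_sum U C (fun u => s * Phi u) n.
Proof.
move=> st; rewrite /partition_sum mulr_sumr; apply: ler_sum => w _.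
have [_ tu] := sup_cylinder w (scale_continuous (s := t)).
have [su _] := sup_cylinder w (scale_continuous (s := s)).
apply: tu => u wu; apply: (@le_trans _ _ (expR (n%:R * - ((t - s) * c)) *
  expR (birkhoff_sum (fun u => s * Phi u) n u))); last first.
  by rewrite ler_wpM2l ?expR_ge0// su.
rewrite -expRD ler_expR !birkhoff_sum_scale.
have : birkhoff_sum Phi n u <= n%:R * - c.
  rewrite mulr_natl -[X in _ *+ X]card_ord -sumr_const.
  by apply: ler_sum => k _; exact: Phic.
have ts : 0 <= t - s by rewrite subr_ge0.
by move=> /(ler_wpM2l ts); lra.
Qed.

Lemma radius_ge (phi : strings N -> R) (z : R) : 0 <= z ->
  cvgn (pseries (zeta_coef U C phi) z) ->
  (z%:E <= convergence_radius (zeta_coef U C phi))%E.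
Proof.
by move=> z0 cz; apply: ereal_sup_ubound; exists z => //; rewrite ger0_norm.
Qed.

Lemma radius_le (phi : strings N -> R) (r : R) :
  (forall z, cvgn (pseries (zeta_coef U C phi) z) -> `|z| <= r) ->
  (convergence_radius (zeta_coef U C phi) <= r%:E)%E.
Proof. by move=> h; apply: ge_ereal_sup => _ [z cz <-]; rewrite lee_fin h. Qed.

(* As Phi <= - c, raising the parameter by d lowers the exponential growth rate of the
   partition sums by at least c d; hence rate 0 at F singles out F. *)
Lemma unique_growth_zero (F : R) : 0 < c ->
  (forall e, 0 < e -> \forall n \near \oo,
     partition_sum U C (fun u => F * Phi u) n <= expR (n%:R * e)) ->
  (forall e, 0 < e -> \forall n \near \oo,
     expR (n%:R * - e) <= partition_sum U C (fun u => F * Phi u) n) ->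
  unique (fun s : R => is_pressure U C (fun u => s * Phi u) 0%E) F /\
  unique (fun s : R =>
    convergence_radius (zeta_coef U C (fun u => s * Phi u)) = 1%E) F.
Proof.
move=> c0 ub lb.
have Z0 s n : 0 <= partition_sum U C (fun u => s * Phi u) n.
  exact: partition_sum_ge0 (scale_continuous (s := s)).
(* Half of the gain [(s - F) * c] pays for the subexponential error at [F]. *)
have above s : F < s -> \forall n \near \oo,
    partition_sum U C (fun u => s * Phi u) n <= expR (n%:R * - ((s - F) * c / 2)).
  move=> Fs; have d0 : 0 < (s - F) * c / 2 by rewrite divr_gt0// mulr_gt0// subr_gt0.
  have := ub _ d0; apply: filterS => n h.
  apply: (le_trans (partition_sum_scale n (ltW Fs))).
  apply: (@le_trans _ _ (expR (n%:R * - ((s - F) * c)) * expR (n%:R * ((s - F) * c / 2)))).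
    by rewrite ler_wpM2l ?expR_ge0.
  by rewrite -expRD -mulrDr (_ : - _ + _ = - ((s - F) * c / 2))//; field.
have below s : s < F -> \forall n \near \oo,
    expR (n%:R * ((F - s) * c / 2)) <= partition_sum U C (fun u => s * Phi u) n.
  move=> sF; have d0 : 0 < (F - s) * c / 2 by rewrite divr_gt0// mulr_gt0// subr_gt0.
  have := lb _ d0; apply: filterS => n h.
  have := le_trans h (partition_sum_scale n (ltW sF)).
  rewrite [leRHS]mulrC -ler_pdivrMr ?expR_gt0// -expRN -expRD.
  by rewrite (_ : _ + _ = n%:R * ((F - s) * c / 2))//; field.
have pos s : F < s -> 0 < (s - F) * c / 2 by move=> h; rewrite divr_gt0// mulr_gt0// subr_gt0.
have pos' s : s < F -> 0 < (F - s) * c / 2 by move=> h; rewrite divr_gt0// mulr_gt0// subr_gt0.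
split; split.
- have le0 : (upper_pressure U C (fun u => F * Phi u)%R <= 0)%E.
    apply/lee_addgt0Pr => e e0; rewrite add0e.
    exact: limn_esup_le_growth (ub _ e0).
  have ge0 : (0 <= lower_pressure U C (fun u => F * Phi u)%R)%E.
    apply/lee_addgt0Pr => e e0; rewrite -leeBlDr// sub0e -EFinN.
    exact: limn_einf_ge_growth (lb _ e0).
  have le : (lower_pressure U C (fun u => F * Phi u)%R <=
    upper_pressure U C (fun u => F * Phi u)%R)%E by exact: limn_einf_sup.
  split; apply/eqP; rewrite eq_le.
    by rewrite (le_trans le le0) ge0.
  by rewrite le0 (le_trans ge0 le).
- move=> s [Ps1 Ps2]; apply/eqP; rewrite eq_le !leNgt; apply/andP; split; apply/negP => h.
    have := limn_einf_ge_growth (below _ h).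
    by rewrite -/(lower_pressure U C (fun u => s * Phi u)%R) Ps1 lee_fin leNgt pos'.
  have := limn_esup_le_growth (above _ h).
  by rewrite -/(upper_pressure U C (fun u => s * Phi u)%R) Ps2 lee_fin oppr_ge0 leNgt pos.
- apply/eqP; rewrite eq_le; apply/andP; split.
    apply/lee_addgt0Pr => e e0; rewrite -EFinD; apply: radius_le => z cz.
    have l0 : 0 < ln (1 + e) by rewrite ln_gt0// ltrDl.
    have := pseries_cvg_le_growth (Z0 F) (lb _ l0) cz.
    by rewrite opprK lnK// posrE addr_gt0.
  apply/lee_addgt0Pr => e e0.
  (* For [1 <= e] the lower bound [1 - e] is not positive, and convergence at 0 is enough. *)
  have [e1|e1] := ltP e 1; last first.
    rewrite -[1%E]add0e leeD// ?lee_fin//.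
    apply: radius_ge => //; apply: (cvg_pseries_growth (Z0 F) (ub _ ltr01)) => //.
  have h1 : 0 < 1 - e by rewrite subr_gt0.
  have h2 : 0 < 1 - e / 2 by rewrite subr_gt0; lra.
  have l0 : 0 < - ln (1 - e / 2) by rewrite oppr_gt0 ln_lt0// h2 /=; lra.
  rewrite -leeBlDr// -EFinB; apply: radius_ge; first exact: ltW.
  apply: (cvg_pseries_growth (Z0 F) (ub _ l0)); first exact: ltW.
  by rewrite opprK lnK ?posrE//; lra.
- move=> s rs; apply/eqP; rewrite eq_le !leNgt; apply/andP; split; apply/negP => h.
    have : (convergence_radius (zeta_coef U C (fun u => s * Phi u)%R) <=
        (expR (- ((F - s) * c / 2))%R)%:E)%E.
      by apply: radius_le => z cz; have := pseries_cvg_le_growth (Z0 s) (below _ h) cz.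
    by rewrite rs lee_fin leNgt expR_lt1 oppr_lt0 pos'.
  (* Half of the rate in [above], to stay strictly inside the interval of convergence that it
     gives. *)
  have : ((expR ((s - F) * c / 4)%R)%:E <=
      convergence_radius (zeta_coef U C (fun u => s * Phi u)%R))%E.
    apply: radius_ge; first exact: expR_ge0.
    apply: (cvg_pseries_growth (Z0 s) (above _ h)); first exact: expR_ge0.
    by rewrite opprK ltr_expR; have := pos _ h; lra.
  rewrite rs lee_fin leNgt expR_gt1.
  by have := pos _ h => h' /negP; apply; lra.
Qed.

End scaling.

(** * The zero of the pressure as a supremum of entropy over energy *)

Theorem corollary5p6 (R : realType) (N : nat) (X : normedModType R)
    (Gamma : borel_prob R N -> X) (Delta : borel_prob R N -> R)
    (C : set X) (Phi : strings N -> R) :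
  let U := fun mu : borel_prob R N => (Delta mu)^-1 *: Gamma mu in
  continuous Gamma -> affine_prob Gamma ->
  continuous Delta -> affine_prob (Delta : borel_prob R N -> R^o) ->
  (forall mu, Delta mu != 0) ->
  closed C -> convex_set (C : set (convex_lmodType X)) ->
  C° `&` (U @` @shift_invariant R N) !=set0 ->
  continuous Phi -> (forall u, Phi u < 0) ->
  exists F : R,
    [/\ unique (fun s : R => is_pressure U C (fun u => s * Phi u) 0%E) F,
        unique (fun s : R =>
          convergence_radius (zeta_coef U C (fun u => s * Phi u)) = 1%E) F
      & F%:E = ereal_sup
          [set (- (entropy (@shift_map N) mu / (\int[mu]_u Phi u)%:E))%E
             | mu in [set mu : borel_prob R N |
                 shift_invariant mu /\ C (U mu)]]].
Proof.
move=> U cG affG cD affD D0 clC convC [x [Cx [nu inu nux]]] cPhi Phi0.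
have Cnu : C° (U nu) by rewrite nux.
have [c c0 Phic] := continuous_lt0_bounded cPhi Phi0.
have [M PhiM] := continuous_bounded cPhi.
have iPhi (mu : borel_prob R N) := continuous_integrable mu cPhi.
have cst_int (mu : borel_prob R N) (a : R) : \int[mu]_u (cst a u) = a.
  have mT : fine (mu setT) = 1 by rewrite probability_setT.
  by rewrite Rintegral_cst// [X in _ * X]mT mulr1.
have icst (mu : borel_prob R N) (a : R) : mu.-integrable setT (EFin \o cst a).
  exact: (@bounded_integrable _ _ _ mu _ `|a|).
have intc (mu : borel_prob R N) : c <= - (\int[mu]_u Phi u).
  rewrite lerNr -(cst_int mu (- c)); apply: le_Rintegral => [||| u _]; [by []|exact: iPhi|exact: icst|exact: Phic].
have intM (mu : borel_prob R N) : - (\int[mu]_u Phi u) <= M.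
  rewrite lerNl -(cst_int mu (- M)); apply: le_Rintegral => [||| u _]; [by []|exact: icst|exact: iPhi|].
  by have := PhiM u; rewrite ler_norml => /andP[].
have int0 (mu : borel_prob R N) : 0 < - (\int[mu]_u Phi u) by exact: lt_le_trans (intc mu).
have M0 : 0 < M := lt_le_trans (int0 nu) (intM nu).
pose P := [set mu : borel_prob R N | shift_invariant mu /\ C (U mu)].
(* The ratio written with a positive denominator: [r mu <= F] then says exactly that entropy plus
   [F] times the integral of [Phi] is at most 0. *)
pose r (mu : borel_prob R N) := coord_entropy mu / - (\int[mu]_u Phi u).
have Pnu : P nu by split => //; exact: interior_subset Cnu.
have E0 : (r @` P) !=set0 by exists (r nu), nu.
have ubE : has_ubound (r @` P).
  exists (ln N.+1%:R / c) => _ [mu [imu _] <-].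
  rewrite /r ler_pdivrMr// (le_trans (coord_entropy_le imu))// mulrAC ler_pdivlMr//.
  by rewrite ler_wpM2l// ln_ge0// ler1n.
pose F := sup (r @` P).
have cFPhi : continuous (fun u => F * Phi u) := scale_continuous cPhi (s := F).
have intF (mu : borel_prob R N) : \int[mu]_u (F * Phi u) = F * \int[mu]_u Phi u.
  by rewrite RintegralZl//; exact: iPhi.
have ub e : 0 < e -> \forall n \near \oo,
    partition_sum U C (fun u => F * Phi u) n <= expR (n%:R * e).
  move=> e0; apply: partition_sum_le => // mu imu Cmu.
  have : r mu <= F by apply: ub_le_sup => //; exists mu.
  by rewrite /r ler_pdivrMr// intF; lra.
have lb e : 0 < e -> \forall n \near \oo,
    expR (n%:R * - e) <= partition_sum U C (fun u => F * Phi u) n.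
  (* Since minus the integral of [Phi] is at most [M], a ratio within [e / 2 / M] of [F] puts
     entropy plus [F] times the integral above [- e / 2]; the other half of [e] goes to
     [partition_sum_ge]. *)
  move=> e0; have eM : 0 < e / 2 / M by rewrite !divr_gt0.
  have [_ [mu [imu Cmu] <-] rmu] := sup_adherent eM (conj E0 ubE).
  have := @partition_sum_ge _ _ _ _ _ cG affG cD affD D0 _ convC _ cFPhi nu mu _
    inu Cnu imu Cmu (divr_gt0 e0 (ltr0n _ 2)).
  apply: filterS => n; apply: le_trans; rewrite ler_expR ler_wpM2l// intF.
  have : (F - e / 2 / M) * - (\int[mu]_u Phi u) <= coord_entropy mu.
    by rewrite -ler_pdivlMr// ltW.
  have : e / 2 / M * - (\int[mu]_u Phi u) <= e / 2.
    by rewrite mulrAC ler_pdivrMr// ler_wpM2l// divr_ge0// ltW.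
  by move=> ? ?; lra.
have [u1 u2] := unique_growth_zero cPhi Phic c0 ub lb.
exists F; split => //.
rewrite -ereal_sup_EFin//; congr ereal_sup; rewrite image_comp.
have rE mu : P mu ->
    (r mu)%:E = (- (entropy (@shift_map N) mu / (\int[mu]_u Phi u)%:E))%E.
  move=> [imu _]; rewrite entropyE// /r invrN mulrN EFinN EFinM.
  by rewrite inver lt_eqF// -oppr_gt0.
by apply/seteqP; split => _ [mu Pmu <-]; exists mu => //=; rewrite rE.
Qed.
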